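(* Let $k$ be an infinite field and $R=k[x_1,\dots,x_n]$. Fix integers $d>d'>0$ and $n\ge 1$ such that $\dim_k R_{d+d'}\ge (\dim_k R_{d'})^2$. If $d'\le 2100$, then for any positive integer $r$ there is an ideal $I$ generated by $r$ forms of degree $d$ in $R$ that has the Hilbert series conjectured by Fröberg up to degree $d+d'$; that is, for every $0\le i\le d+d'$, $\dim_k (R/I)_i$ equals the coefficient of $t^i$ in $\left[\frac{(1-t^d)^r}{(1-t)^n}\right]$.
   Context: $R=k[x_1,\dots,x_n]$ is the standard graded polynomial ring and $R_i$ denotes its degree $i$ part; a form of degree $d$ is an element of $R_d$. For a power series $\sum_i a_i t^i$ with integer coefficients, $\left[\sum_i a_it^i\right]$ denotes its truncation at the first non-positive coefficient, i.e. $\sum_i b_it^i$ where $b_i=a_i$ if $a_0,\dots,a_i>0$ and $b_i=0$ otherwise. The Hilbert series conjectured by Fröberg for an ideal generated by $r$ generic forms of degree $d$ in $n$ variables is $\left[\frac{(1-t^d)^r}{(1-t)^n}\right]$. *)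

(* Defs.v *)
From HB Require Import structures.
From mathcomp Require Import all_boot all_order all_algebra.
From mathcomp Require Import mpoly.

Set Implicit Arguments.
Unset Strict Implicit.
Unset Printing Implicit Defensive.

Import GRing.Theory Num.Theory.
Local Open Scope ring_scope.

Definition infinite_type (T : eqType) : Prop :=
  ~ exists s : seq T, forall x : T, x \in s.

Definition ideal_gen (n : nat) (k : fieldType) (r : nat)
    (f : 'I_r -> {mpoly k[n]}) : {mpoly k[n]} -> Prop :=
  fun p => exists g : 'I_r -> {mpoly k[n]}, p = \sum_(j < r) g j * f j.

(* The library equips [dhomog n k i], the space of forms of degree [i] in [n]
   variables, with a [vectType] structure only when [n] is a successor; hence
   the [n.+1] below.

   [m] is the dimension of the degree [i] part of the quotient by [I]: this part
   is the quotient of the forms of degree [i] by those lying in [I], which are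
   required to be the elements of the subspace [U]. *)
Definition quot_dim (n : nat) (k : fieldType) (I : {mpoly k[n.+1]} -> Prop)
    (i m : nat) : Prop :=
  exists2 U : {vspace dhomog n.+1 k i},
    forall p : dhomog n.+1 k i, p \in U <-> I (mpoly_of_dhomog p)
    & m = (\dim {: dhomog n.+1 k i} - \dim U)%N.

Lemma quot_dim_uniq (n : nat) (k : fieldType) (I : {mpoly k[n.+1]} -> Prop)
    (i m1 m2 : nat) : quot_dim I i m1 -> quot_dim I i m2 -> m1 = m2.
Proof.
case=> U1 HU1 -> [U2 HU2 ->]; suff -> : U1 = U2 by [].
apply/vspaceP=> p; apply/idP/idP => Hp.
- by apply/HU2/HU1.
- by apply/HU1/HU2.
Qed.

(* Formal power series with integer coefficients: [a] stands for
   [\sum_i a i * t ^ i]. *)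
Definition series := nat -> int.

Definition series_of_poly (p : {poly int}) : series := fun i => p`_i.

Definition series_mul (a b : series) : series :=
  fun i => \sum_(j < i.+1) a j * b (i - j)%N.

(* 1 / (1 - t) ^ n, from 1 / (1 - t) = 1 + t + t ^ 2 + ... *)
Definition inv_pow_series (n : nat) : series :=
  iter n (series_mul (fun _ => 1)) (series_of_poly 1).

Definition froberg_quotient (n d r : nat) : series :=
  series_mul (series_of_poly ((1 - 'X^d) ^+ r)) (inv_pow_series n).

Lemma series_mul_trunc (a b : series) (N i : nat) : (i < N)%N ->
  series_mul a b i = ((\poly_(j < N) a j) * (\poly_(j < N) b j))`_i.
Proof.
move=> iN; rewrite coefM; apply: eq_bigr => j _; rewrite !coef_poly.
by rewrite (leq_ltn_trans _ iN) ?(leq_ltn_trans _ iN) ?leq_subr // -ltnS.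
Qed.

Lemma series_mulC (a b : series) : series_mul a b =1 series_mul b a.
Proof. by move=> i; rewrite !(@series_mul_trunc _ _ i.+1) // mulrC. Qed.

Lemma eq_series_mul (a a' b b' : series) :
  a =1 a' -> b =1 b' -> series_mul a b =1 series_mul a' b'.
Proof. by move=> ea eb i; apply: eq_bigr => j _; rewrite ea eb. Qed.

Lemma series_mulA (a b c : series) :
  series_mul a (series_mul b c) =1 series_mul (series_mul a b) c.
Proof.
move=> i; rewrite /series_mul.
pose P (u : series) : {poly int} := \poly_(j < i.+1) u j.
transitivity ((P a * (P b * P c))`_i).
  rewrite [RHS]coefM; apply: eq_bigr => j _; rewrite coef_poly ltn_ord.
  by congr (_ * _); rewrite -(@series_mul_trunc b c i.+1) // ltnS leq_subr.
rewrite mulrA [LHS]coefM; apply: eq_bigr => j _.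
rewrite coef_poly ltnS leq_subr; congr (_ * _).
by rewrite -(@series_mul_trunc a b i.+1) // ltn_ord.
Qed.

Lemma series_of_polyE (p : {poly int}) (i : nat) : series_of_poly p i = p`_i.
Proof. by []. Qed.

Lemma series_of_polyM (p q : {poly int}) :
  series_of_poly (p * q) =1 series_mul (series_of_poly p) (series_of_poly q).
Proof. by move=> i; rewrite /series_of_poly coefM. Qed.

Lemma series_mul1 (a : series) : series_mul (series_of_poly 1) a =1 a.
Proof.
move=> i; rewrite /series_mul big_ord_recl series_of_polyE coef1 mul1r subn0.
by rewrite big1 ?addr0 // => j _; rewrite series_of_polyE coef1 mul0r.
Qed.

Lemma series_mul_geom :
  series_mul (series_of_poly (1 - 'X)) (fun _ => 1) =1 series_of_poly 1.
Proof.
case=> [|i]; rewrite /series_mul !series_of_polyE.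
  by rewrite big_ord1 series_of_polyE coefB !coef1 coefX.
by rewrite 2!big_ord_recl big1 => [|j _];
  rewrite !series_of_polyE !coefB !coef1 !coefX.
Qed.

Lemma inv_pow_seriesP (n : nat) :
  series_mul (series_of_poly ((1 - 'X) ^+ n)) (inv_pow_series n)
    =1 series_of_poly 1.
Proof.
elim: n => [|n IHn] i; first by rewrite expr0 series_mul1.
rewrite exprSr /inv_pow_series iterS -/(inv_pow_series n).
rewrite (eq_series_mul (series_of_polyM _ _) (frefl _)) -series_mulA.
rewrite (eq_series_mul (frefl _) (series_mulA _ _ _)).
rewrite (eq_series_mul (frefl _)
          (eq_series_mul series_mul_geom (frefl (inv_pow_series n)))).
by rewrite (eq_series_mul (frefl _) (series_mul1 _)) IHn.
Qed.

Lemma froberg_quotientP (n d r : nat) :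
  series_mul (series_of_poly ((1 - 'X) ^+ n)) (froberg_quotient n d r)
    =1 series_of_poly ((1 - 'X^d) ^+ r).
Proof.
move=> i; rewrite /froberg_quotient.
rewrite (eq_series_mul (frefl _) (series_mulC _ _)) series_mulA.
by rewrite (eq_series_mul (inv_pow_seriesP n) (frefl _)) series_mul1.
Qed.

Definition series_truncate (a : series) : series :=
  fun i => if [forall j : 'I_i.+1, 0 < a j] then a i else 0.

Definition froberg_series (n d r : nat) : series :=
  series_truncate (froberg_quotient n d r).

(* Main.v *)
Require Import Defs.
From HB Require Import structures.
From mathcomp Require Import all_boot all_order all_algebra.
From mathcomp Require Import all_fingroup all_solvable all_field.
From mathcomp Require Import mpoly.
From mathcomp Require Import Rstruct.
From mathcomp Require Import zify ring lra.
From Stdlib Require Rdefinitions Rtrigo_def Exp_prop Rpower Ranalysis1 MVT.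
From Stdlib Require Import Classical IndefiniteDescription.

(** Write [N], [E], [D] for the dimensions of the forms of degrees [m], [d],
    [d + m]. Since [m <= d' < d], only linear syzygies matter: the claim is that
    for some forms [f_1, ..., f_r] of degree [d] the maps [R_m^r -> R_(d+m)],
    [g |-> \sum_j g_j f_j], have maximal rank for all [m <= d'].

    Count over a finite field with [q] elements. If [g] spans a space [G] of
    dimension [s], the tuples [f] with [\sum_j g_j f_j = 0] form a space of
    codimension [dim (G R_d)], and there are about [q ^ (s (N - s) + r s)] such
    [g]; syzygies being scalable, almost no [f] has one as soon as
    [dim (G R_d) >= s (N - s + r)]. Dually, failure of surjectivity is counted
    by the functionals on [R_(d+m)] according to the kernel of their
    catalecticant. For [r <= D / N] and [r >= D / N] respectively, both counts
    follow from [N dim (G R_d) >= s (D + N (N - s))].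

    Passing to leading monomials, this says that if [t] monomials of degree [m]
    contain all divisors of degree [m] of [b] monomials of degree [d + m], then
    [N b <= t (D - N (N - t))]. Write [t = C(x + m - 1, m)] with [x] real; the
    Lovasz form of Macaulay's theorem gives [b <= C(x + m + d - 1, m + d)], and
    one compares [b / t - t] at [x] with its value [D / N - N >= 0] at the
    number of variables.

    An element of a finite field is the value of some [X^i] (or 0) at a
    generator of the multiplicative group, so that the matrices lift to integer
    polynomials in one variable, which can be specialised in the infinite
    field. *)

Set Implicit Arguments.
Unset Strict Implicit.
Unset Printing Implicit Defensive.

Import Order.TTheory GRing.Theory Num.Theory.
Local Open Scope ring_scope.

(** * Shadows of multisets *)

Definition weight (I : finType) (c : {ffun I -> nat}) : nat := (\sum_v c v)%N.

Definition decr (I : finType) (c : {ffun I -> nat}) (v : I) : {ffun I -> nat} :=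
  [ffun u => (c u - (u == v))%N].

(** The polynomial [C(x + m - 1, m)] in [x]: the number of monomials of degree [m] in [x] variables,
    extended to non-integral [x]. *)
Definition multichoose (F : fieldType) (x : F) (m : nat) : F :=
  \prod_(i < m) ((x + i%:R) / i.+1%:R).

Lemma multichooseSl (F : numFieldType) (x : F) (m : nat) :
  multichoose x m.+1 = x / m.+1%:R * multichoose (x + 1) m.
Proof.
rewrite /multichoose !big_split /= !prodfV big_ord_recl /= addr0.
rewrite [X in _ * X^-1]big_ord_recr /= invfM.
rewrite (eq_bigr (fun i : 'I_m => x + 1 + i%:R)); last first.
  by move=> i _; rewrite -addrA nat1r.
ring.
Qed.

Lemma weight_decr (I : finType) (c : {ffun I -> nat}) v :
  (0 < c v)%N -> (weight (decr c v)).+1 = weight c.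
Proof.
move=> cv; rewrite /weight (bigD1 v) // [in RHS](bigD1 v) //= ffunE eqxx.
rewrite (eq_bigr c) => [|u /negPf uv]; last by rewrite ffunE uv subn0.
by rewrite -addSn subn1 prednK.
Qed.

Lemma decr_inj (I : finType) (v : I) (c c' : {ffun I -> nat}) :
  (0 < c v)%N -> (0 < c' v)%N -> decr c v = decr c' v -> c = c'.
Proof.
move=> cv c'v /ffunP E; apply/ffunP => u; move: (E u); rewrite !ffunE.
by case: eqP => [->|_]; lia.
Qed.

(* Removes one factor [v] from [c] and moves [e] others to a new variable: for
   [e < c v] these are the [c v] copies of [c] in the weighted link of [v]. *)
Definition link_shift (I : finType) (v : I) (c : {ffun I -> nat}) (e : nat) :
    {ffun option I -> nat} :=
  [ffun w => if w is Some u then (c u - (u == v) * e.+1)%N else e].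

Definition link (I : finType) (v : I) (T : seq {ffun I -> nat}) :=
  [seq link_shift v c e | c <- T, e <- iota 0 (c v)].

Lemma link_shift_inj (I : finType) (v : I) (c c' : {ffun I -> nat}) e e' :
  (e < c v)%N -> (e' < c' v)%N -> link_shift v c e = link_shift v c' e' ->
  c = c' /\ e = e'.
Proof.
move=> ec e'c' /ffunP E; have := E None; rewrite !ffunE => ee; subst e'.
split=> //; apply/ffunP => u; have := E (Some u); rewrite !ffunE.
by case: eqP => [->|_]; lia.
Qed.

Lemma size_link (I : finType) (v : I) T :
  size (link v T) = (\sum_(c <- T) c v)%N.
Proof.
rewrite size_allpairs_dep sumnE big_map.
by apply: eq_bigr => c _; rewrite size_iota.
Qed.

Lemma link_uniq (I : finType) (v : I) T : uniq T -> uniq (link v T).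
Proof.
move=> uT; apply: allpairs_uniq_dep => // [c _|]; first exact: iota_uniq.
move=> p q /allpairsPdep[c [e [cT]]]; rewrite mem_iota => /andP[_ ec] ->.
move=> /allpairsPdep[c' [e' [c'T]]]; rewrite mem_iota => /andP[_ ec'] -> /=.
by case/link_shift_inj=> // -> ->.
Qed.

Lemma linkP (I : finType) (v : I) (T : seq {ffun I -> nat}) w :
  reflect (exists (c : {ffun I -> nat}) e,
             [/\ c \in T, (e < c v)%N & w = link_shift v c e])
          (w \in link v T).
Proof.
apply: (iffP allpairsPdep) => -[c [e [cT]]].
  by rewrite mem_iota add0n => /andP[_ ec] ->; exists c, e.
by move=> ec ->; exists c, e; rewrite mem_iota.
Qed.

Lemma weight_link_shift (I : finType) (v : I) (c : {ffun I -> nat}) e :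
  (e < c v)%N -> (weight (link_shift v c e)).+1 = weight c.
Proof.
move=> ec; rewrite /weight (bigD1 None) //= (reindex_omap Some id) //=.
rewrite (eq_bigl xpredT) => [|u]; last by rewrite eqxx.
rewrite ffunE (bigD1 v) //= [in RHS](bigD1 v) //= ffunE eqxx mul1n.
rewrite (eq_bigr c) => [|u /negPf uv].
- by rewrite addnA -addSn; congr (_ + _)%N; lia.
- by rewrite ffunE uv mul0n subn0.
- by case.
Qed.

Lemma link_closed (I : finType) (v : I) (T B : seq {ffun I -> nat}) :
  (forall (c : {ffun I -> nat}) u, c \in B -> (0 < c u)%N -> decr c u \in T) ->
  forall (w : {ffun option I -> nat}) z,
    w \in link v B -> (0 < w z)%N -> decr w z \in link v T.
Proof.
move=> TB w z /linkP[c [e [cB ec ->]]]; case: z => [u|]; rewrite ffunE => wz.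
- have cu : (0 < c u)%N by lia.
  apply/linkP; exists (decr c u), e; split; first exact: TB.
    by rewrite ffunE; move: wz; rewrite eq_sym; case: eqP => [->|]; lia.
  apply/ffunP => -[y|]; rewrite !ffunE // ?subn0 //.
  by rewrite (inj_eq Some_inj) -!subnDA addnC.
- apply/linkP; exists (decr c v), e.-1; split.
  + by apply: TB => //; apply: leq_ltn_trans ec.
  + rewrite ffunE eqxx; case: (e) wz ec => // e' _.
    by case: (c v) => // n; rewrite subn1.
  + apply/ffunP => -[y|]; rewrite !ffunE /=; last by rewrite subn1.
    case: (e) wz => // e' _; rewrite subn0 /=.
    by case: eqP => _; rewrite ?mul1n ?mul0n ?subn0 // -!subnDA.
Qed.

(* The analogue of Keevash's proof of the Lovasz form of the Kruskal-Katona
   theorem. *)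
Lemma upper_shadow_bound (F : realFieldType) (m : nat) (I : finType) (x : F)
    (T B : seq {ffun I -> nat}) :
  0 < x -> (0 < m)%N -> uniq T -> uniq B ->
  (forall c : {ffun I -> nat}, c \in T -> weight c = m) ->
  (forall c : {ffun I -> nat}, c \in B -> weight c = m.+1) ->
  (forall (c : {ffun I -> nat}) v, c \in B -> (0 < c v)%N -> decr c v \in T) ->
  (size T)%:R <= multichoose x m ->
  m.+1%:R * (size B)%:R <= (x + m%:R) * (size T)%:R.
Proof.
elim: m I x T B => // m IHm I x T B x0 _ uT uB wT wB TB leT.
pose K v : nat := (\sum_(c <- B) c v)%N.
pose D v : nat := (\sum_(c <- T) c v)%N.
have sumK : (\sum_v K v = m.+2 * size B)%N.
  rewrite exchange_big /= (eq_big_seq (fun=> m.+2)) => [|c /wB //].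
  by rewrite big_const_seq count_predT iter_addn_0 mulnC.
have sumD : (\sum_v D v = m.+1 * size T)%N.
  rewrite exchange_big /= (eq_big_seq (fun=> m.+1)) => [|c /wT //].
  by rewrite big_const_seq count_predT iter_addn_0 mulnC.
(* Removing one [v] embeds the members of [B] containing [v] into [T] and lowers their multiplicity
   at [v] by one. *)
have K_le v : (K v <= size T + D v)%N.
  rewrite /K (bigID (fun c : {ffun I -> nat} => 0 < c v)%N) /=.
  rewrite [X in (_ + X)%N]big1 ?addn0 => [|c]; last first.
    by rewrite lt0n negbK => /eqP.
  rewrite -big_filter.
  rewrite (eq_big_seq (fun c : {ffun I -> nat} => (decr c v v).+1)); last first.
    by move=> c; rewrite mem_filter ffunE eqxx subn1 => /andP[/prednK].
  rewrite -(big_map (fun c : {ffun I -> nat} => decr c v) predT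
                    (fun u : {ffun I -> nat} => (u v).+1)).
  set S := map _ _; have uS : uniq S.
    rewrite map_inj_in_uniq ?filter_uniq // => c c'; rewrite !mem_filter.
    by move=> /andP[cv _] /andP[c'v _]; apply: decr_inj.
  have sST : {subset S <= T}.
    by move=> _ /mapP[c + ->]; rewrite mem_filter => /andP[cv cB]; apply: TB.
  have -> : (size T + D v = \sum_(u <- T) (u v).+1)%N.
    rewrite (eq_bigr (fun u : {ffun I -> nat} => 1 + u v)%N) // big_split /=.
    by rewrite sum1_size.
  rewrite (perm_big (filter (mem S) T)).
    by rewrite big_filter [leqRHS](bigID (mem S)) /= leq_addr.
  apply: uniq_perm; rewrite ?filter_uniq // => u; rewrite mem_filter /=.
  by case: (boolP (u \in S)) => //= /sST ->.
suff K_bound v : m.+1%:R * (K v)%:R <= (x + m.+1%:R) * (D v)%:R.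
  have : \sum_v m.+1%:R * (K v)%:R <= \sum_v (x + m.+1%:R) * (D v)%:R :> F.
    by apply: ler_sum => v _; apply: K_bound.
  rewrite -!mulr_sumr -!natr_sum sumK sumD !natrM [leRHS]mulrCA.
  by rewrite ler_pM2l ?ltr0n.
(* If [D v] is large, [K_le] suffices. Otherwise the link of [v] in [T] is small enough for the
   induction hypothesis at [x + 1]; the lowest degree is settled directly. *)
have [leD|ltD] := lerP (m.+1%:R * (size T)%:R) (x * (D v)%:R).
  have : m.+1%:R * (K v)%:R <= m.+1%:R * (size T + D v)%:R :> F.
    by rewrite ler_pM2l ?ltr0n // ler_nat.
  rewrite natrD mulrDr mulrDl; lra.
case: m => [|m] in IHm wT wB leT sumK sumD ltD *.
  have [D0|D0] := posnP (D v).
    suff -> : K v = 0%N by rewrite D0 !mulr0.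
    apply: big1_seq => c /andP[_ cB]; apply/eqP; apply: contraT.
    rewrite -lt0n => cv; have wc := wB c cB.
    have [u du] : exists u, (0 < decr c v u)%N.
      apply/existsP; apply: contraT; rewrite negb_exists => /forallP z.
      have := weight_decr cv; rewrite wc /weight big1 // => u _.
      by apply/eqP; rewrite -leqn0 leqNgt z.
    have cu : (0 < c u)%N by apply: leq_trans du _; rewrite ffunE leq_subr.
    have duv : (0 < decr c u v)%N.
      move: du; rewrite !ffunE.
      by case: (eqVneq u v) => [->|_]; rewrite ?eqxx ?subn0 ?subn0.
    have duT := TB c u cB cu.
    have : (decr c u v <= D v)%N by rewrite /D (big_rem _ duT) /= leq_addr.
    by rewrite D0 leqNgt duv.
  have : (size T)%:R <= x.
    by move: leT; rewrite /multichoose big_ord1 addr0 divr1.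
  have : (K v)%:R <= (size T)%:R + (D v)%:R :> F by rewrite -natrD ler_nat.
  have : 1 <= (D v)%:R :> F by rewrite ler1n.
  move: ltD; rewrite !mul1r; nra.
have := IHm _ (x + 1) (link v T) (link v B); rewrite !size_link -/(K v) -/(D v).
rewrite -addrA nat1r => h; apply: h; rewrite ?link_uniq //.
- lra.
- by move=> w /linkP[c [e [/wT cT ec ->]]]; have := weight_link_shift ec; lia.
- by move=> w /linkP[c [e [/wB cT ec ->]]]; have := weight_link_shift ec; lia.
- exact: link_closed.
(* The size [D v] of the link is below [multichoose (x + 1) m.+1]: divide
   [x * D v < m.+2 * multichoose x m.+2] by [x]. *)
have := lt_le_trans ltD (ler_wpM2l (ler0n _ m.+2) leT).
rewrite multichooseSl [_ * (_ * _)]mulrA [m.+2%:R * _]mulrC divfK ?pnatr_eq0 //.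
by rewrite ltr_pM2l // => /ltW.
Qed.

(** The one-step bound is applied degree by degree: the bound obtained for the divisors [S] of
    degree [m + d] keeps their number at most [multichoose x (m + d)], as the next step requires. *)
Lemma iterated_shadow_bound (F : realFieldType) (m d : nat) (I : finType)
    (x : F) (T B : seq {ffun I -> nat}) :
  0 < x -> (0 < m)%N -> uniq T -> uniq B ->
  (forall c : {ffun I -> nat}, c \in T -> weight c = m) ->
  (forall c : {ffun I -> nat}, c \in B -> weight c = (m + d)%N) ->
  (forall c u : {ffun I -> nat}, c \in B -> weight u = m ->
     (forall v, u v <= c v)%N -> u \in T) ->
  (size T)%:R <= multichoose x m ->
  (size B)%:R <= (size T)%:R * \prod_(j < d) ((x + (m + j)%:R) / (m + j).+1%:R).
Proof.
move=> x0 m0 uT; elim: d B => [|d IHd] B uB wT wB TB leT.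
  rewrite big_ord0 mulr1 ler_nat; apply: uniq_leq_size => // c cB.
  by apply: (TB c) => //; rewrite (wB c cB) addn0.
pose S := undup [seq decr c v | c <- B, v <- [seq v <- enum I | 0 < c v]%N].
have SP w : w \in S -> exists c v, [/\ c \in B, (0 < c v)%N & w = decr c v].
  rewrite mem_undup => /allpairsPdep[c [v [cB]]]; rewrite mem_filter.
  by case/andP=> cv _ ->; exists c, v.
have wS c : c \in S -> weight c = (m + d)%N.
  by case/SP=> c' [v [/wB + cv ->]]; have := weight_decr cv; lia.
have leS : (size S)%:R <=
    (size T)%:R * \prod_(j < d) ((x + (m + j)%:R) / (m + j).+1%:R).
  apply: IHd => //; first exact: undup_uniq.
  move=> _ u /SP[c [v [cB _ ->]]] wu leu; apply: (TB c) => // z.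
  by apply: leq_trans (leu z) _; rewrite ffunE leq_subr.
have md0 : (0 < m + d)%N by rewrite addn_gt0 m0.
have wB' (c : {ffun I -> nat}) : c \in B -> weight c = (m + d).+1.
  by move=> /wB ->; rewrite addnS.
have BS (c : {ffun I -> nat}) v : c \in B -> (0 < c v)%N -> decr c v \in S.
  move=> cB cv; rewrite mem_undup; apply/allpairsPdep; exists c, v; split=> //.
  by rewrite mem_filter cv mem_enum.
have leS' : (size S)%:R <= multichoose x (m + d).
  apply: le_trans leS _; rewrite /multichoose big_split_ord /=.
  apply: ler_wpM2r leT; apply: prodr_ge0 => j _.
  by rewrite divr_ge0 ?ler0n ?addr_ge0 ?ler0n ?ltW.
have le := upper_shadow_bound x0 md0 (undup_uniq _) uB wS wB' BS leS'.
rewrite big_ord_recr /= mulrA.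
have : (m + d).+1%:R * (size B)%:R <= (x + (m + d)%:R) *
   ((size T)%:R * \prod_(j < d) ((x + (m + j)%:R) / (m + j).+1%:R)).
  by apply: le_trans le _; apply: ler_wpM2l leS; rewrite addr_ge0 ?ler0n ?ltW.
rewrite mulrC -ler_pdivlMr ?ltr0n // => h; apply: le_trans h _.
by rewrite [leRHS]mulrA [_ * (x + _)]mulrC.
Qed.

(** * The numerical inequality *)

Section RealCurve.
Local Notation R := Rdefinitions.R.
Local Notation ln := Rpower.ln.
Local Notation exp := Rtrigo_def.exp.
Local Notation is_deriv := Ranalysis1.derivable_pt_lim.

(** With [x = y + 1], both [multichoose x m] and the product in [iterated_shadow_bound] have this
    form; for positive [A i] every factor is 1 at [y = 0]. *)
Definition linprod (k : nat) (A : nat -> R) (y : R) : R :=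
  \prod_(i < k) ((y + A i) / A i).

Definition lnprod (k : nat) (A : nat -> R) (y : R) : R :=
  \sum_(i < k) ln ((y + A i) / A i).

Lemma exp_lnprod k A y : (forall i, 0 < A i) -> 0 <= y ->
  exp (lnprod k A y) = linprod k A y.
Proof.
move=> A0 y0; rewrite /lnprod /linprod.
have expD : {morph exp : u v / (u : R) + v >-> u * v}.
  exact: Exp_prop.exp_plus.
rewrite (big_morph exp expD Rtrigo_def.exp_0); apply: eq_bigr => i _.
by apply: Rpower.exp_ln; apply/RltP; rewrite divr_gt0 // ltr_wpDl.
Qed.

Lemma deriv_lnprod k A y : (forall i, 0 < A i) -> 0 <= y ->
  is_deriv (lnprod k A) y (\sum_(i < k) (y + A i)^-1).
Proof.
move=> A0 y0; rewrite /lnprod; elim: k => [|k IHk].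
  rewrite big_ord0.
  have := Ranalysis1.derivable_pt_lim_const 0 y.
  by apply: Ranalysis1.derivable_pt_lim_ext => z; rewrite big_ord0.
rewrite big_ord_recr /=.
apply: (Ranalysis1.derivable_pt_lim_ext (fun z => Rdefinitions.Rplus
  (\sum_(i < k) ln ((z + A i) / A i)) (ln ((z + A k) / A k)))).
  by move=> z; rewrite big_ord_recr.
apply: Ranalysis1.derivable_pt_lim_plus => //.
have d1 : is_deriv (fun z : R => (z + A k) / A k) y (A k)^-1.
  have dplus := Ranalysis1.derivable_pt_lim_plus _ _ _ _ _
    (Ranalysis1.derivable_pt_lim_id y)
    (Ranalysis1.derivable_pt_lim_const (A k) y).
  have := Ranalysis1.derivable_pt_lim_mult _ _ _ _ _ dplus
    (Ranalysis1.derivable_pt_lim_const (A k)^-1 y).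
  rewrite /Ranalysis1.fct_cte !(RplusE, RmultE) R1E R0E addr0 mul1r mulr0 addr0.
  exact: Ranalysis1.derivable_pt_lim_ext.
have yA : 0 < (y + A k) / A k by rewrite divr_gt0 // ltr_wpDl.
have d2 := Rpower.derivable_pt_lim_ln _ (elimT RltP yA).
have := Ranalysis1.derivable_pt_lim_comp _ _ _ _ _ d1 d2.
congr (is_deriv _ _ _); rewrite RmultE RinvE.
have := A0 k; have : 0 < y + A k by rewrite ltr_wpDl.
by move=> ? ?; field; lra.
Qed.


Lemma linprod_gt0 k A y : (forall i, 0 < A i) -> 0 <= y -> 0 < linprod k A y.
Proof.
by move=> A0 y0; apply: prodr_gt0 => i _; rewrite divr_gt0 // ltr_wpDl.
Qed.

Lemma ler_linprod k A x y : (forall i, 0 < A i) -> 0 <= x -> x <= y ->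
  linprod k A x <= linprod k A y.
Proof.
move=> A0 x0 xy; apply: ler_prod => i _; have Ai := A0 i.
apply/andP; split; first by rewrite divr_ge0 ?addr_ge0 // ltW.
by rewrite ler_pM2r ?invr_gt0 // lerD2r.
Qed.

Lemma ltr_exp_inv u v : exp u < exp v -> u < v.
Proof. by move/RltP/Rpower.exp_lt_inv/RltP. Qed.

Lemma mean_value (f g : R -> R) a b : a < b ->
  (forall c, a <= c <= b -> is_deriv f c (g c)) ->
  exists2 c, a < c < b & f b - f a = g c * (b - a).
Proof.
move=> ab fg; have [c [e [/RltP ac /RltP cb]]] :=
  MVT.MVT_cor2 f g a b (elimT RltP ab) (fun c h =>
    fg c (introT andP (conj (introT RleP (proj1 h)) (introT RleP (proj2 h))))).
by exists c; rewrite ?ac ?cb.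
Qed.

(* All roots of [linprod k A] lie to the left of [- m] and those of
   [linprod l B] to the right. Hence [z + m] times the logarithmic derivative of
   their quotient increases, so once that derivative is positive it stays
   positive. *)
Lemma linprod_gap (k l m : nat) (A B : nat -> R) (x y : R) :
  (forall i, m%:R < A i) -> (forall i, (i < l)%N -> 0 < B i <= m%:R) ->
  (forall i, 0 < B i) ->
  0 <= x -> x <= y -> linprod l B y <= linprod k A y ->
  linprod k A x - linprod l B x <= linprod k A y - linprod l B y.
Proof.
move=> Am Bm B0 x0 xy gy.
have A0 i : 0 < A i by apply: le_lt_trans (Am i); rewrite ler0n.
have y0 : 0 <= y by apply: le_trans xy.
have [le|lt] := lerP (linprod k A x) (linprod l B x).
  by apply: (@le_trans _ _ 0); rewrite ?subr_le0 ?subr_ge0.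
pose H z := lnprod k A z - lnprod l B z.
pose G (z : R) := \sum_(i < k) (z + A i)^-1 - \sum_(i < l) (z + B i)^-1.
have HG z : 0 <= z -> is_deriv H z (G z).
  by move=> z0; apply: Ranalysis1.derivable_pt_lim_minus; apply: deriv_lnprod.
have expH z : 0 <= z -> exp (H z) * linprod l B z = linprod k A z.
  move=> z0; rewrite -!exp_lnprod // -[_ * _]Exp_prop.exp_plus RplusE.
  by rewrite /H subrK.
have H0 : H 0 = 0.
  have ln0 (a : R) : 0 < a -> ln ((0 + a) / a) = 0.
    by move=> a0; rewrite add0r divff ?gt_eqF // Rpower.ln_1.
  by rewrite /H /lnprod !big1 ?subrr // => i _; apply: ln0.
have Hx : 0 < H x.
  apply: ltr_exp_inv; rewrite Rtrigo_def.exp_0.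
  rewrite -(ltr_pM2r (linprod_gt0 l B0 x0)).
  by rewrite expH // R1E mul1r.
have x_gt0 : 0 < x.
  by rewrite lt_neqAle x0 andbT; apply/eqP => x00; rewrite -x00 H0 ltxx in Hx.
(* As [H] vanishes at 0 and is positive at [x], its derivative [G] is positive somewhere in
   between. *)
have [c /andP[c0 cx]] : exists2 c, 0 < c < x & H x - H 0 = G c * (x - 0).
  by apply: mean_value => // c /andP[c0 _]; apply: HG.
rewrite H0 !subr0 => Hxc.
have Gc : 0 < G c by rewrite -(pmulr_lgt0 _ x_gt0) -Hxc.
have G_incr z : c <= z -> 0 <= G z.
  move=> cz; have z0 : 0 < z by apply: lt_le_trans cz.
  have zm : 0 < z + m%:R by rewrite ltr_wpDr.
  rewrite -(pmulr_rge0 _ zm); apply: (@le_trans _ _ ((c + m%:R) * G c)).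
    by rewrite mulr_ge0 ?ltW // ltr_wpDr.
  rewrite /G !mulrBr !mulr_sumr; apply: lerB; apply: ler_sum => i _.
  - have := Am i; set a := A i => am; have m0 : 0 <= m%:R :> R by [].
    rewrite ler_pdivrMr; last lra.
    rewrite mulrAC ler_pdivlMr; last lra.
    nra.
  - have := Bm i (ltn_ord i); set b := B i => /andP[b0 bm].
    rewrite ler_pdivrMr; last lra.
    rewrite mulrAC ler_pdivlMr; last lra.
    nra.
have leH : H x <= H y.
  move: xy; rewrite le_eqVlt => /orP[/eqP-> //|xy].
  have [|z /andP[xz zy]] := @mean_value H G x y xy.
    by move=> z /andP[xz _]; apply: HG; apply: le_trans xz.
  rewrite -subr_ge0 => ->; apply: mulr_ge0; last by rewrite subr_ge0 ltW.
  by apply: G_incr; rewrite ltW // (lt_trans cx).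
have leexp : exp (H x) <= exp (H y).
  move: leH; rewrite le_eqVlt => /orP[/eqP-> //|/RltP h].
  by apply/ltW/RltP/Rpower.exp_increasing.
(* The difference at [z] is [(exp (H z) - 1) * linprod l B z]; both factors are nonnegative and do
   not decrease from [x] to [y]. *)
rewrite -!expH //.
have e1 : 1 <= exp (H x).
  apply/ltW/RltP; rewrite -R1E -Rtrigo_def.exp_0.
  by apply/Rpower.exp_increasing/RltP.
have := ler_linprod l B0 x0 xy; have := linprod_gt0 l B0 x0.
nra.
Qed.


Lemma multichoose_nat (F : numFieldType) n m :
  multichoose (n.+1%:R : F) m = 'C(m + n, m)%:R.
Proof.
elim: m => [|m IHm]; first by rewrite /multichoose big_ord0 bin0.
rewrite /multichoose big_ord_recr /= -/(multichoose _ m) IHm -natrD.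
apply: (mulIf (x := m.+1%:R)); first by rewrite pnatr_eq0.
by rewrite -mulrA divfK ?pnatr_eq0 // -!natrM mulnC addSn [in RHS]mulnC
  -mul_bin_diag addSn addnC /=; congr (_ * _)%:R; rewrite addnC addnS.
Qed.

(** Intermediate value theorem, between the values 1 at [y = 0] and ['C(m + n, m)] at [y = n]. *)
Lemma multichoose_exists n m t : (0 < t)%N -> (t <= 'C(m + n, m))%N ->
  exists2 y : R, 0 <= y <= n%:R & multichoose (y + 1) m = t%:R.
Proof.
move=> t0 tN.
pose p : {poly R} := \prod_(i < m) (i.+1%:R^-1 *: ('X + i.+1%:R%:P)) - t%:R%:P.
have pE y : p.[y] = multichoose (y + 1) m - t%:R.
  rewrite /p !hornerE horner_prod /multichoose; congr (_ - _).
  by apply: eq_bigr => i _; rewrite !hornerE -addrA nat1r mulrC.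
have [||y yn] := @poly_ivt _ p 0 n%:R; first exact: ler0n.
  rewrite !pE add0r natr1 (multichoose_nat _ 0) multichoose_nat.
  by rewrite addn0 binn subr_ge0 subr_le0 !ler_nat t0.
by rewrite rootE pE subr_eq0 => /eqP ?; exists y.
Qed.

(** Write [t = multichoose (y + 1) m] with [y <= n], so that [b <= t * linprod d A y]. After
    division by [t * N] it suffices that [linprod d A y <= D / N - (N - t)], which is [linprod_gap]
    between [y] and [n]; its hypothesis at [n] is [N ^ 2 <= D]. *)
Lemma shadow_numeric n m d t b : (0 < m)%N -> (0 < t)%N ->
  (t <= 'C(m + n, m))%N -> ('C(m + n, m) ^ 2 <= 'C(m + d + n, m + d))%N ->
  (forall x : R, 0 < x -> t%:R <= multichoose x m ->
     b%:R <= t%:R * \prod_(j < d) ((x + (m + j)%:R) / (m + j).+1%:R)) ->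
  (b * 'C(m + n, m) <=
     t * ('C(m + d + n, m + d) - 'C(m + n, m) * ('C(m + n, m) - t)))%N.
Proof.
move=> m0 t0 tN; set N := 'C(_, _) in tN *; set D := 'C(_, _) => ND bound.
have [y /andP[y0 yn] yt] := multichoose_exists t0 tN.
pose A i : R := (m + i).+1%:R; pose B i : R := i.+1%:R.
have multiE (z : R) : multichoose (z + 1) m = linprod m B z.
  by apply: eq_bigr => i _; rewrite -addrA nat1r.
have prodE (z : R) :
    \prod_(j < d) ((z + 1 + (m + j)%:R) / (m + j).+1%:R) = linprod d A z.
  by apply: eq_bigr => i _; rewrite -addrA nat1r.
have NE : N%:R = linprod m B n%:R by rewrite -multiE natr1 multichoose_nat.
have DE : D%:R = N%:R * linprod d A n%:R.
  rewrite /D -multichoose_nat /multichoose big_split_ord /= -natr1.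
  by rewrite prodE NE -multiE.
have N0 : 0 < N%:R :> R by rewrite ltr0n; apply: leq_trans tN.
have gap : linprod d A y - linprod m B y <= linprod d A n%:R - linprod m B n%:R.
  apply: (@linprod_gap _ _ m) => //.
  - by move=> i; rewrite ltr_nat ltnS leq_addr.
  - by move=> i im; rewrite ltr0n ler_nat.
  - by rewrite -NE -(ler_pM2l N0) -DE -natrM ler_nat mulnn.
have by1 : b%:R <= t%:R * linprod d A y.
  by rewrite -prodE; apply: bound; rewrite ?ltr_wpDl // yt.
(* Makes the truncated subtraction of the goal a true one. *)
have le : (N * (N - t) <= D)%N.
  by apply: leq_trans ND; rewrite -mulnn leq_mul2l leq_subr orbT.
rewrite -(ler_nat R) !natrM natrB // natrM natrB // DE.
rewrite -multiE yt -NE in gap.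
have t0' : 0 < t%:R :> R by rewrite ltr0n.
apply: (@le_trans _ _ (t%:R * linprod d A y * N%:R)).
  by rewrite ler_pM2r.
rewrite -mulrA ler_pM2l // [leLHS]mulrC -mulrBr ler_pM2l //; lra.
Qed.

End RealCurve.

(** * Products of a space of forms with all forms of degree d *)

Lemma bin_stars_gt0 n a : (0 < 'C(a + n, a))%N.
Proof. by rewrite bin_gt0 leq_addr. Qed.

Definition monomials (n d : nat) : seq 'X_{1..n} :=
  [seq s2m t | t : d.-tuple 'I_n <- enum (basis n d)].

Definition mon (n d : nat) (a : 'I_('C(d + n, d))) : 'X_{1..n.+1} :=
  nth 0%MM (monomials n.+1 d) a.

Lemma mon_mem n d (a : 'I_('C(d + n, d))) : mon a \in monomials n.+1 d.
Proof. by rewrite mem_nth // size_basis. Qed.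

Lemma mdeg_mon n d (a : 'I_('C(d + n, d))) : mdeg (mon a) = d.
Proof. by apply/eqP; rewrite basis_cover mon_mem. Qed.

Lemma mon_inj n d : injective (@mon n d).
Proof.
move=> a b /eqP; rewrite nth_uniq ?size_basis ?uniq_basis //.
by move/eqP/val_inj.
Qed.

Lemma monP n d (u : 'X_{1..n.+1}) : mdeg u = d -> exists a, u = @mon n d a.
Proof.
move/eqP; rewrite basis_cover => um.
have lt : (index u (monomials n.+1 d) < 'C(d + n, d))%N.
  by rewrite -size_basis index_mem.
by exists (Ordinal lt); rewrite /mon nth_index.
Qed.

(** * Leading monomials of a space of forms *)

Section LeadingSets.
Variables (F : finFieldType) (n N : nat) (lab : 'I_N -> 'X_{1..n}).
Hypothesis lab_inj : injective lab.

Definition is_lead (v : 'rV[F]_N) (a : 'I_N) : bool :=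
  (v 0 a != 0) && [forall b, (v 0 b != 0) ==> (lab b <= lab a)%O].

Definition lead_set (s : nat) (Y : 'M[F]_(s, N)) : {set 'I_N} :=
  [set a | [exists v : 'rV_N, (v <= Y)%MS && is_lead v a]].

Lemma lead_exists (v : 'rV[F]_N) : v != 0 -> exists a, is_lead v a.
Proof.
move=> v0; have /existsP[a0 va0] : [exists a, v 0 a != 0].
  apply: contraT; rewrite negb_exists => /forallP va; case/eqP: v0.
  by apply/rowP => a; apply/eqP; have := va a; rewrite negbK mxE.
have := @arg_maxP _ _ _ a0 (fun a => v 0 a != 0) lab va0.
case=> a va amax; exists a; rewrite /is_lead va; apply/forallP => b.
by apply/implyP => vb; apply: amax.
Qed.

Lemma lead_setP (s : nat) (Y : 'M[F]_(s, N)) a :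
  reflect (exists2 v : 'rV_N, (v <= Y)%MS & is_lead v a) (a \in lead_set Y).
Proof.
by rewrite inE; apply: (iffP existsP) => [[v /andP[]]|[v ? ?]]; exists v => //;
  apply/andP.
Qed.

(** Vectors with distinct leading labels are independent. Conversely, restriction to the columns in
    the lead set is injective on the row space, since it keeps a nonzero leading coefficient. *)
Lemma card_lead_set (s : nat) (Y : 'M[F]_(s, N)) : #|lead_set Y| = \rank Y.
Proof.
apply/eqP; rewrite eqn_leq; apply/andP; split.
- pose A := lead_set Y.
  have ex (i : 'I_#|A|) :
      exists v : 'rV[F]_N, (v <= Y)%MS && is_lead v (enum_val i).
    by have /lead_setP[v vY vl] := enum_valP i; exists v; apply/andP.
  pose V : 'M[F]_(#|A|, N) := \matrix_i xchoose (ex i).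
  have VP i : (row i V <= Y)%MS && is_lead (row i V) (enum_val i).
    by rewrite rowK; apply: (xchooseP (ex i)).
  suff /eqP <- : row_free V.
    by apply: mxrankS; apply/row_subP => i; case/andP: (VP i).
  apply: inj_row_free => u uV; apply/eqP; apply: contraT => u0.
  have /existsP[i0 ui0] : [exists i, u 0 i != 0].
    apply: contraT; rewrite negb_exists => /forallP ui; case/eqP: u0.
    by apply/rowP => i; apply/eqP; have := ui i; rewrite negbK mxE.
  have := @arg_maxP _ _ _ i0 (fun i => u 0 i != 0)
    (fun i => lab (enum_val i)) ui0.
  case=> i ui imax; have /andP[_ /andP[Vi _]] := VP i.
  have /rowP/(_ (enum_val i)) := uV; rewrite !mxE (bigD1 i) //= big1 => [|k ki].
    move/eqP; rewrite addr0 mulf_eq0 (negPf ui) /=; rewrite !mxE in Vi.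
    by rewrite mxE (negPf Vi).
  have [->|uk] := eqVneq (u 0 k) 0; first by rewrite mul0r.
  have [->|Vk] := eqVneq (V k (enum_val i)) 0; first by rewrite mulr0.
  have /andP[_ /andP[_ /forallP/(_ (enum_val i))]] := VP k.
  rewrite mxE Vk /= => le; have le' := imax k uk.
  case/eqP: ki; apply/enum_val_inj/lab_inj/le_anti.
  by apply/andP; split; [exact: le'|exact: le].
- pose f (i : 'I_#|lead_set Y|) : 'I_N := enum_val i.
  suff /eqP <- : row_free (colsub f (row_base Y)) by apply: rank_leq_col.
  apply: inj_row_free => u; rewrite mulmx_colsub => uY.
  have [uY0|/lead_exists[a la]] := eqVneq (u *m row_base Y) 0.
    by apply: (row_free_inj (row_base_free Y)); rewrite mul0mx.
  have aY : a \in lead_set Y.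
    apply/lead_setP; exists (u *m row_base Y) => //.
    by rewrite (submx_trans (submxMl _ _)) // eq_row_base.
  have := congr1 (fun w : 'rV_#|lead_set Y| => w 0 (enum_rank_in aY a)) uY.
  rewrite mxE /f enum_rankK_in // [RHS]mxE => va.
  by case/andP: la; rewrite va eqxx.
Qed.
End LeadingSets.

(** Turns a bound on the numbers [N - s] and [D - r] of non-leading monomials into one on the
    dimensions [s] and [r] of a space and of its product with all forms of degree [d]. *)
Lemma complement_arith N D s r : (s <= N)%N -> (r <= D)%N -> (N * s <= D)%N ->
  ((D - r) * N <= (N - s) * (D - N * s))%N ->
  (s * (D + N * (N - s)) <= N * r)%N.
Proof.
move=> /subnKC; set t := (N - s)%N => <- /subnKC; set b := (D - r)%N => De.
move=> /subnKC; set e := (D - _)%N => De' le; rewrite -De'.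
have : ((s + t) * (r + b) = (s + t) * ((s + t) * s + e))%N by rewrite De De'.
nia.
Qed.

Section ShadowOfSubspace.
Variables (n d m : nat).
Local Notation N := 'C(m + n, m).
Local Notation E := 'C(d + n, d).
Local Notation D := 'C(d + m + n, d + m).

(** Multiplication by the monomial [mon a], from forms of degree [d] to forms of degree [d + m],
    acting on rows of coefficients. *)
Definition mon_mul (R : nzRingType) (a : 'I_N) : 'M[R]_(E, D) :=
  \matrix_(b, c) (mon c == (mon a + mon b)%MM)%:R.

Definition vec_mul (R : nzRingType) (v : 'rV[R]_N) : 'M[R]_(E, D) :=
  \sum_a v 0 a *: mon_mul R a.

(** The span of the products of forms in the row space of [Y] with forms of degree [d]. *)
Definition space_mul (F : fieldType) (s : nat) (Y : 'M[F]_(s, N)) : 'M[F]_D :=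
  (\sum_(i < s) <<vec_mul (row i Y)>>)%MS.

Lemma vec_mulE (R : nzRingType) (v : 'rV[R]_N) b c :
  vec_mul v b c = \sum_a v 0 a * (mon c == (mon a + mon b)%MM)%:R.
Proof. by rewrite summxE; apply: eq_bigr => a _; rewrite !mxE. Qed.

Lemma vec_mul_is_linear (R : comNzRingType) : linear (@vec_mul R).
Proof.
move=> k u v; rewrite /vec_mul scaler_sumr -big_split /=.
by apply: eq_bigr => a _; rewrite !mxE scalerDl scalerA.
Qed.
HB.instance Definition _ (R : comNzRingType) :=
  GRing.isLinear.Build R _ _ _ (@vec_mul R) (@vec_mul_is_linear R).

Lemma vec_mul_sub (F : fieldType) (s : nat) (Y : 'M[F]_(s, N)) (v : 'rV_N) :
  (v <= Y)%MS -> (vec_mul v <= space_mul Y)%MS.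
Proof.
case/submxP => w ->; rewrite mulmx_sum_row linear_sum /=.
apply: summx_sub => i _; rewrite linearZ /=; apply: scalemx_sub.
by rewrite (sumsmx_sup i) // genmxE.
Qed.

(** Row [b] of [vec_mul v] holds the coefficients of [v] times [mon b], and the monomial order is
    compatible with multiplication. *)
Lemma is_lead_mul (F : finFieldType) (v : 'rV[F]_N) a b c :
  is_lead (@mon n m) v a -> mon c = (mon a + mon b)%MM ->
  is_lead (@mon n (d + m)) (row b (vec_mul v)) c.
Proof.
case/andP=> va /forallP vmax cab; apply/andP; split.
  rewrite mxE vec_mulE (bigD1 a) //= cab eqxx mulr1 big1 ?addr0 // => a' a'a.
  by rewrite eqm_add2r eq_sym (inj_eq (@mon_inj _ _)) (negPf a'a) mulr0.
apply/forallP => c'; apply/implyP; rewrite mxE vec_mulE.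
apply: contraNT; rewrite cab -ltNge => lt; apply/eqP/big1 => a' _.
have [->|va'] := eqVneq (v 0 a') 0; first by rewrite mul0r.
have := vmax a'; rewrite va' /= => le; case: eqP => [e|]; last by rewrite mulr0.
by move: lt; rewrite e ltmc_add2l ltNge le.
Qed.

Definition expo (u : 'X_{1..n.+1}) : {ffun 'I_n.+1 -> nat} := [ffun i => u i].

Lemma expo_inj : injective expo.
Proof.
by move=> u v /ffunP e; apply/mnmP => i; have := e i; rewrite !ffunE.
Qed.

Lemma weight_expo u : weight (expo u) = mdeg u.
Proof. by rewrite mdegE; apply: eq_bigr => i _; rewrite ffunE. Qed.

(** A divisor of degree [m] of a monomial that does not lead in the product cannot lead in [Y], so
    the shadow bound applies to the non-leading monomials. *)
Lemma space_mul_rank (F : finFieldType) (s : nat) (Y : 'M[F]_(s, N)) :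
  (N ^ 2 <= D)%N -> row_free Y ->
  (s * (D + N * (N - s)) <= N * \rank (space_mul Y))%N.
Proof.
move=> ND /eqP rY.
pose A := lead_set (@mon n m) Y.
pose C := lead_set (@mon n (d + m)) (space_mul Y).
have cA : #|A| = s by rewrite card_lead_set ?rY //; apply: mon_inj.
have cC : #|C| = \rank (space_mul Y).
  by rewrite card_lead_set //; apply: mon_inj.
pose T := [seq expo (mon a) | a in ~: A].
pose B := [seq expo (mon c) | c in ~: C].
have sT : size T = (N - s)%N.
  by rewrite size_map -cardE cardsCs setCK card_ord cA.
have sB : size B = (D - \rank (space_mul Y))%N.
  by rewrite size_map -cardE cardsCs setCK card_ord cC.
have closed (c u : {ffun 'I_n.+1 -> nat}) :
    c \in B -> weight u = m -> (forall v, u v <= c v)%N -> u \in T.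
  move=> /mapP[{}c + ->] wu leu; rewrite mem_enum inE => cC'.
  pose u' : 'X_{1..n.+1} := [multinom u i | i < n.+1].
  have uE : u = expo u' by apply/ffunP => i; rewrite !ffunE mnmE.
  have [a u'a] : exists a, u' = @mon n m a.
    by apply: monP; rewrite -weight_expo -uE.
  rewrite uE u'a; apply: map_f; rewrite mem_enum inE; apply: contra cC'.
  have le : (mon a <= mon c)%MM.
    by apply/mnm_lepP => i; have := leu i; rewrite uE u'a !ffunE.
  have [b cab] : exists b, (mon c - mon a)%MM = @mon n d b.
    apply: monP; apply/eqP; rewrite -(eqn_add2r (mdeg (mon a))) -mdegD submK //.
    by rewrite !mdeg_mon.
  case/lead_setP => v vY va; apply/lead_setP; exists (row b (vec_mul v)).
    by rewrite (submx_trans (row_sub _ _)) ?vec_mul_sub.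
  by apply: is_lead_mul va _; rewrite -cab addmC submK.
have shadow (x : Rdefinitions.R) : (0 < m)%N -> 0 < x ->
    (size T)%:R <= multichoose x m ->
    (size B)%:R <=
      (size T)%:R * \prod_(j < d) ((x + (m + j)%:R) / (m + j).+1%:R).
  move=> m0 x0; apply: (@iterated_shadow_bound _ _ _ 'I_n.+1) => //.
  - by rewrite map_inj_uniq ?enum_uniq // => a b /expo_inj/mon_inj.
  - by rewrite map_inj_uniq ?enum_uniq // => a b /expo_inj/mon_inj.
  - by move=> _ /mapP[a _ ->]; rewrite weight_expo mdeg_mon.
  - by move=> _ /mapP[a _ ->]; rewrite weight_expo mdeg_mon addnC.
have sN : (s <= N)%N by rewrite -cA -[leqRHS]card_ord max_card.
have rD : (\rank (space_mul Y) <= D)%N by apply: rank_leq_col.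
(* [shadow_numeric] covers [m > 0] with [T] nonempty. If [T] is empty, so is [B]; if [m = 0] and [T]
   is not empty, then [N = 1] and [s = 0]. *)
have key : (size B * N <= size T * (D - N * s))%N.
  have [T0|T0] := posnP (size T).
    suff -> : B = [::] by [].
    have [m0|m0] := posnP m.
      case EB: B => [//|c B']; have cB : c \in B by rewrite EB mem_head.
      have := closed c [ffun=> 0%N] cB; rewrite (size0nil T0) m0.
      move=> h; have []// : false; apply: h => [|v]; last by rewrite ffunE.
      by apply: big1 => v _; rewrite ffunE.
    have := shadow 1 m0 ltr01; rewrite T0 mul0r => h; apply: size0nil.
    apply/eqP; rewrite -leqn0 -(ler_nat Rdefinitions.R); apply: h.
    by apply: prodr_ge0 => i _; rewrite divr_ge0 ?addr_ge0 ?ler01 ?ler0n.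
  have [m0|m0] := posnP m.
    have s0 : s = 0%N by move: T0; rewrite sT m0 add0n bin0; case: (s).
    by rewrite s0 muln0 subn0 sT s0 subn0 mulnC leq_mul2l sB leq_subr orbT.
  have := @shadow_numeric n m d (size T) (size B) m0 T0.
  rewrite sT subKn // [(m + d)%N]addnC => h; apply: h; rewrite ?leq_subr //.
  by rewrite -sT => x; apply: shadow.
have NsD : (N * s <= D)%N.
  by apply: leq_trans ND; rewrite -mulnn leq_mul2l sN orbT.
by apply: complement_arith; rewrite // -sT -sB.
Qed.

End ShadowOfSubspace.

(** * Counting over a finite field *)

Lemma card_bigcup_le (I T : finType) (A : pred I) (S : I -> {set T}) :
  (#|\bigcup_(i | A i) S i| <= \sum_(i | A i) #|S i|)%N.
Proof.
elim/big_ind2: _ => [|A1 n1 A2 n2 le1 le2|//]; first by rewrite cards0.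
by apply: leq_trans (leq_card_setU _ _) _; apply: leq_add.
Qed.

Section RankCount.
Variable F : finFieldType.
Local Notation q := #|F|.

Lemma card_field_gt0 : (0 < q)%N.
Proof. by apply/card_gt0P; exists 0. Qed.

Lemma card_ker (r k l : nat) (M : 'M[F]_(k, l)) :
  (#|[set U : 'M[F]_(r, k) | U *m M == 0%R]| <= q ^ (r * (k - \rank M)))%N.
Proof.
rewrite -mxrank_ker -card_mx -cardsT.
rewrite (leq_trans _ (leq_imset_card (fun W => W *m row_base (kermx M)) _)) //.
apply: subset_leq_card; apply/subsetP => U; rewrite inE => /eqP UM.
have /submxP[W ->] : (U <= row_base (kermx M))%MS.
  by rewrite eq_row_base; apply/sub_kermxP.
exact: imset_f.
Qed.

Lemma card_coker (k l : nat) (M : 'M[F]_(k, l)) :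
  (#|[set u : 'cV[F]_l | M *m u == 0%R]| <= q ^ (l - \rank M))%N.
Proof.
have := card_ker 1 M^T; rewrite mul1n mxrank_tr; apply: leq_trans.
rewrite -(card_imset _ (@trmx_inj _ _ _)); apply: subset_leq_card.
apply/subsetP => _ /imsetP[u + ->]; rewrite !inE => /eqP uM.
by rewrite -trmx_mul uM trmx0.
Qed.

(** Bases normalised to the identity on the columns [h]. Every space of dimension [s] has one for
    some [h], so the [N ^ s] maps [h] replace an exact count of subspaces. *)
Definition normal_bases (s N : nat) (h : {ffun 'I_s -> 'I_N}) :
    {set 'M[F]_(s, N)} :=
  [set Y | colsub h Y == 1%:M%R].

Lemma normal_basis_free s N (h : {ffun 'I_s -> 'I_N}) Y :
  Y \in normal_bases h -> row_free Y.
Proof.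
rewrite inE => /eqP hY; apply: inj_row_free => u uY.
by rewrite -[u]mulmx1 -hY mulmx_colsub uY; apply/matrixP => i j; rewrite !mxE.
Qed.

(** Only the entries outside the columns [h] are free, and a nonempty set forces [h] to be
    injective, which leaves [N - s] columns. *)
Lemma card_normal_bases s N (h : {ffun 'I_s -> 'I_N}) :
  (#|normal_bases h| <= q ^ (s * (N - s)))%N.
Proof.
have [->|/set0Pn[Y0 Y0h]] := eqVneq (normal_bases h) set0.
  by rewrite cards0.
have hI : injective h.
  move=> i j hij; move: Y0h; rewrite inE => /eqP/matrixP hY.
  have : (1%:M : 'M[F]_s) i i = 1%:M i j by rewrite -!hY !mxE hij.
  by rewrite !mxE eqxx; case: eqVneq => // _ /eqP; rewrite oner_eq0.
pose C := ~: (h @: setT).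
have cC : #|C| = (N - s)%N.
  by rewrite cardsCs setCK card_ord card_imset // cardsT card_ord.
rewrite -cC -card_mx -cardsT.
pose f (Y : 'M[F]_(s, N)) : 'M_(s, #|C|) :=
  colsub (fun i : 'I_#|C| => enum_val i) Y.
rewrite -(card_in_imset (f := f)) ?subset_leq_card ?subsetT //.
move=> Y1 Y2; rewrite !inE => /eqP/matrixP h1 /eqP/matrixP h2 /matrixP f12.
apply/matrixP => i j; have [jC|] := boolP (j \in C).
  by have := f12 i (enum_rank_in jC j); rewrite !mxE !enum_rankK_in.
rewrite inE negbK => /imsetP[l _ ->].
by have := h1 i l; have := h2 i l; rewrite !mxE => -> ->.
Qed.

Lemma normal_basis_exists k N (A : 'M[F]_(k, N)) :
  exists h : {ffun 'I_(\rank A) -> 'I_N},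
    exists2 Y, Y \in normal_bases h & (Y :=: A)%MS.
Proof.
pose Z := row_base A; have full : row_full Z^T.
  by rewrite /row_full mxrank_tr eq_row_base.
exists (fullrankfun full); pose W := colsub (fullrankfun full) Z.
have Wu : W \in unitmx.
  by have := fullrowsub_unit full; rewrite -unitmx_tr trmx_mxsub trmxK.
exists (invmx W *m Z); first by rewrite inE -mulmx_colsub mulVmx.
apply: eqmx_trans (eq_row_base A); apply: eqmxMfull.
by rewrite row_full_unit unitmx_inv.
Qed.

(** Write [A = X *m Y] with [Y] a normalised basis of the row space: there are [N ^ s] choices of
    [h], then [s (N - s)] and [k s] free entries. *)
Lemma card_rank (k N s : nat) :
  (#|[set A : 'M[F]_(k, N) | \rank A == s]| <= N ^ s * q ^ (s * (k + N - s)))%N.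
Proof.
pose f (p : 'M[F]_(s, N) * 'M[F]_(k, s)) := p.2 *m p.1.
pose P (h : {ffun 'I_s -> 'I_N}) := f @: setX (normal_bases h) setT.
have [Ns|sN] := ltnP N s.
  rewrite (_ : [set A | _] = set0) ?cards0 //; apply/setP => A.
  rewrite !inE; apply/negbTE.
  by rewrite ltn_eqF // (leq_ltn_trans _ Ns) ?rank_leq_col.
apply: (@leq_trans #|\bigcup_h P h|).
  apply: subset_leq_card; apply/subsetP => A; rewrite inE => /eqP rA; subst s.
  have [h [Y Yh YA]] := normal_basis_exists A.
  have /submxP[X AX] : (A <= Y)%MS by rewrite YA.
  apply/bigcupP; exists h => //; apply/imsetP.
  by exists (Y, X) => //; apply/setXP.
apply: leq_trans (card_bigcup_le _ _) _.
have -> : (s * (k + N - s) = s * (N - s) + k * s)%N.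
  by rewrite -addnBA // mulnDr addnC [(k * s)%N]mulnC.
have le h : (#|P h| <= q ^ (s * (N - s) + k * s))%N.
  apply: leq_trans (leq_imset_card _ _) _; rewrite cardsX cardsT card_mx expnD.
  by rewrite leq_mul2r card_normal_bases orbT.
apply: (@leq_trans (\sum_(h : {ffun 'I_s -> 'I_N}) q ^ (s * (N - s) + k * s))).
  exact: leq_sum.
by rewrite sum_nat_const card_ffun !card_ord.
Qed.

(** Double counting of the pairs [(t, v)] with [v] nonzero in [K t]: by scaling, each [t] in [B] has
    at least [q - 1] of them. This factor makes the bad tuples rare for large [q]. *)
Lemma card_scalable_fibers (T : finType) (V : finLmodType F) (B : {set T})
    (K : T -> {set V}) :
  (forall t, t \in B -> exists2 v, v != 0 & v \in K t) ->
  (forall t c v, v \in K t -> c *: v \in K t) ->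
  (#|B| * q.-1 <=
     \sum_(v : V | v != 0%R) #|[set t | v \in K t]|)%N.
Proof.
move=> BK scal.
rewrite (eq_bigr (fun v : V => \sum_(t | v \in K t) 1)%N); last first.
  by move=> v _; rewrite sum1_card; apply: eq_card => t; rewrite inE.
rewrite (exchange_big_dep xpredT) //= -sum_nat_const.
rewrite [leqRHS](bigID (mem B)) /= -[leqLHS]addn0 leq_add //.
apply: leq_sum => t tB; rewrite sum1_card; have [v v0 vK] := BK t tB.
rewrite -(cardC1 (0 : F)).
rewrite -(card_imset _ (f := fun c : F => c *: v)); last first.
  move=> a b /eqP; rewrite -subr_eq0 -scalerBl scaler_eq0 (negPf v0) orbF.
  by rewrite subr_eq0 => /eqP.
apply: subset_leq_card; apply/subsetP => _ /imsetP[c c0 ->].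
rewrite unfold_in /= scaler_eq0 negb_or v0 andbT; apply/andP.
by split; [|exact: scal].
Qed.

End RankCount.

(** Meant for the syzygies or functionals of a fixed rank: at most [C * Q] members, each of weight
    at most [W / Q]. *)
Lemma weighted_count (T : finType) (P : pred T) (w : T -> nat) (C Q W : nat) :
  (0 < Q)%N -> (forall t, P t -> (w t * Q <= W)%N) -> (#|P| <= C * Q)%N ->
  (\sum_(t | P t) w t <= C * W)%N.
Proof.
move=> Q0 wQ cP; rewrite -(leq_pmul2r Q0) big_distrl /=.
apply: (@leq_trans (\sum_(t | P t) W)); first exact: leq_sum.
by rewrite sum_nat_const mulnAC leq_mul2r cP orbT.
Qed.

(** * Tuples of forms without maximal rank *)

Section GenericRank.
Variables (n d m r : nat).
Local Notation N := 'C(m + n, m).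
Local Notation E := 'C(d + n, d).
Local Notation D := 'C(d + m + n, d + m).

Definition comb (R : comNzRingType) (Phi : 'M[R]_(r, E)) (g : 'M[R]_(r, N)) :
    'rV[R]_D :=
  \sum_i row i Phi *m vec_mul d (row i g).

(** The matrix of the pairing [(u, w) |-> phi (u w)] between forms of degrees [m] and [d], for [phi]
    a functional on forms of degree [d + m]. *)
Definition catalecticant (R : comNzRingType) (phi : 'cV[R]_D) : 'M[R]_(N, E) :=
  \matrix_(a, b) (mon_mul d R a *m phi) b 0.

Lemma mul_catalecticant (R : comNzRingType) (phi : 'cV[R]_D) (v : 'rV[R]_N) :
  v *m catalecticant phi = (vec_mul d v *m phi)^T.
Proof.
apply/rowP => b; rewrite !mxE; under eq_bigr do rewrite !mxE big_distrr /=.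
rewrite exchange_big /=; apply: eq_bigr => c _.
rewrite vec_mulE big_distrl /=; apply: eq_bigr => a _.
by rewrite mulrA !mxE.
Qed.

Section Finite.
Variable F : finFieldType.
Local Notation q := #|F|.

Definition combl (g : 'M[F]_(r, N)) (v : 'rV[F]_(r * E)) := comb (vec_mx v) g.

Lemma combl_is_linear g : linear (combl g).
Proof.
move=> k u v; rewrite /combl /comb scaler_sumr -big_split /=.
apply: eq_bigr => i _.
by rewrite linearP /= linearP /= mulmxDl scalemxAl.
Qed.
HB.instance Definition _ g :=
  GRing.isLinear.Build F _ _ _ (combl g) (@combl_is_linear g).

(** The product of [row i g] with a monomial is the value of [combl g] at the tuple whose only
    nonzero entry is this monomial, in place [i]. *)
Lemma space_mul_sub_comb (g : 'M[F]_(r, N)) :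
  (space_mul d g <= lin1_mx (combl g))%MS.
Proof.
apply/sumsmx_subP => i _; rewrite genmxE; apply/row_subP => b.
apply/submxP; exists (mxvec (delta_mx i b)).
rewrite mul_rV_lin1 /= /combl mxvecK /comb (bigD1 i) //= big1 ?addr0.
  rewrite rowE; congr (_ *m _); apply/rowP => b'.
  by rewrite !mxE !eqxx.
move=> k /negPf ki; rewrite (_ : row k _ = 0) ?mul0mx //.
by apply/rowP => b'; rewrite !mxE ki.
Qed.

Lemma space_mul_rank_gen (g : 'M[F]_(r, N)) :
  (N ^ 2 <= D)%N ->
  (\rank g * (D + N * (N - \rank g)) <= N * \rank (space_mul d g))%N.
Proof.
move=> ND; apply: leq_trans (space_mul_rank ND (row_base_free g)) _.
rewrite leq_mul2l mxrankS ?orbT //; apply/sumsmx_subP => i _; rewrite genmxE.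
by apply: vec_mul_sub; rewrite (submx_trans (row_sub _ _)) ?eq_row_base.
Qed.

(** Collects the choices of normalising columns over all ranks; being independent of the field, it
    is outweighed by a large [q]. *)
Definition rank_const : nat := (\sum_(s < N.+1) N ^ s)%N.

Definition non_injective : {set 'M[F]_(r, E)} :=
  [set Phi | [exists g : 'M[F]_(r, N), (g != 0) && (comb Phi g == 0)]].

(* [Phi *m (catalecticant phi)^T == 0] says that [phi] vanishes on the image of
   [comb Phi]. *)
Definition non_surjective : {set 'M[F]_(r, E)} :=
  [set Phi | [exists phi : 'cV[F]_D,
     (phi != 0) && (Phi *m (catalecticant phi)^T == 0)]].

(** Group the [g] by rank [s]. At most [N ^ s * q ^ (s (r + N - s))] have this rank, and each is a
    syzygy of a space of tuples of codimension at least [s (r + N - s)], by [space_mul_rank_gen] and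
    [r N <= D]. *)
Lemma card_non_injective :
  (N ^ 2 <= D)%N -> (r * N <= D)%N ->
  (#|non_injective| * q.-1 <= rank_const * q ^ (r * E))%N.
Proof.
move=> ND rND.
pose K (Phi : 'M[F]_(r, E)) := [set g : 'M[F]_(r, N) | comb Phi g == 0].
have := @card_scalable_fibers F _ _ non_injective K.
move=> /(_ _ _)/leq_trans; apply.
- move=> Phi; rewrite inE => /existsP[g /andP[g0 gP]].
  by exists g; rewrite ?inE.
- move=> Phi c g; rewrite !inE => /eqP gP; apply/eqP.
  rewrite -[RHS](scaler0 _ c) -gP /comb scaler_sumr; apply: eq_bigr => i _.
  by rewrite !linearZ /= scalemxAr.
pose rk (g : 'M[F]_(r, N)) : 'I_N.+1 := inord (\rank g).
rewrite (partition_big rk xpredT) //= big_distrl /=; apply: leq_sum => s _.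
apply: (@weighted_count _ _ _ _ (q ^ (s * (r + N - s)))).
- by rewrite expn_gt0 card_field_gt0.
- move=> g /andP[g0 /eqP gs]; have {gs}rg : \rank g = s.
    by rewrite -gs inordK // ltnS rank_leq_col.
  pose M := lin1_mx (combl g).
  have le1 : (#|[set Phi | g \in K Phi]| <= q ^ (r * E - \rank M))%N.
    have := @card_ker F 1 _ _ M; rewrite mul1n; apply: leq_trans.
    rewrite -(card_imset _ (can_inj (@mxvecK _ r E))).
    apply: subset_leq_card; apply/subsetP => _ /imsetP[Phi + ->].
    by rewrite !inE mul_rV_lin1 /= /combl mxvecK.
  have le2 : (s * (r + N - s) <= \rank M)%N.
    apply: leq_trans (mxrankS (space_mul_sub_comb g)).
    rewrite -(leq_pmul2l (bin_stars_gt0 n m)).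
    apply: leq_trans (space_mul_rank_gen g ND).
    rewrite rg mulnCA leq_mul2l -addnBA; last by rewrite -ltnS.
    by rewrite mulnDr leq_add2r mulnC rND orbT.
  apply: leq_trans (leq_mul le1 (leqnn _)) _.
  rewrite -expnD leq_pexp2l ?card_field_gt0 //.
  rewrite -(leq_add2l (\rank M)) addnA subnKC ?rank_leq_row //.
  by rewrite [leqRHS]addnC leq_add2l.
- apply: leq_trans (card_rank F r N s); apply: subset_leq_card.
  apply/subsetP => g; rewrite unfold_in inE => /andP[_ /eqP gs].
  by rewrite -gs inordK // ltnS rank_leq_col.
Qed.

(** Let [G], of dimension [t], be the left kernel of the catalecticant; then [phi] vanishes on the
    products of [G] with the forms of degree [d]. Choose a normalised basis of [G], then [phi] in
    the annihilator. *)
Lemma card_small_catalecticant (t : nat) :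
  (t <= r)%N -> (N ^ 2 <= D)%N -> (D <= r * N)%N ->
  (#|[set phi : 'cV[F]_D | (N - \rank (catalecticant phi))%N == t]|
     <= N ^ t * q ^ (t * (N - t) + (D - (t * (N - t) + D - r * (N - t)))))%N.
Proof.
(* A lower bound for the rank of [space_mul d Y], by [space_mul_rank] and [D <= r N]; the
   subtraction may be truncated to 0. *)
move=> tr ND DrN; set l := (t * (N - t) + D - r * (N - t))%N.
pose P (h : {ffun 'I_t -> 'I_N}) :=
  \bigcup_(Y in normal_bases F h)
     [set phi : 'cV[F]_D | space_mul d Y *m phi == 0].
apply: (@leq_trans #|\bigcup_h P h|).
  apply: subset_leq_card; apply/subsetP => phi; rewrite inE => /eqP rphi.
  move: rphi; rewrite -mxrank_ker => rphi; subst t.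
  have [h [Y Yh YK]] := normal_basis_exists (kermx (catalecticant phi)).
  apply/bigcupP; exists h => //; apply/bigcupP; exists Y => //; rewrite inE.
  have YC : Y *m catalecticant phi = 0 by apply/sub_kermxP; rewrite YK.
  have kerphi v : (v <= Y)%MS -> vec_mul d v *m phi = 0.
    case/submxP => w vY; apply: trmx_inj; rewrite -mul_catalecticant vY -mulmxA.
    by rewrite YC mulmx0 trmx0.
  apply/eqP/sub_kermxP; apply/sumsmx_subP => i _; rewrite genmxE.
  by apply/sub_kermxP/kerphi/row_sub.
apply: leq_trans (card_bigcup_le _ _) _.
have leP h : (#|P h| <= q ^ (t * (N - t) + (D - l)))%N.
  apply: leq_trans (card_bigcup_le _ _) _; rewrite expnD.
  apply: (@leq_trans (\sum_(Y in normal_bases F h) q ^ (D - l))); last first.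
    by rewrite sum_nat_const leq_mul2r card_normal_bases orbT.
  apply: leq_sum => Y Yh; apply: leq_trans (card_coker _) _.
  rewrite leq_pexp2l ?card_field_gt0 // leq_sub2l //.
  have /eqP rY := normal_basis_free Yh.
  rewrite -(leq_pmul2l (bin_stars_gt0 n m)).
  apply: leq_trans (space_mul_rank ND (normal_basis_free Yh)).
  rewrite /l mulnBr leq_subLR.
  have tN : (t <= N)%N by rewrite -rY rank_leq_col.
  have : (D * (N - t) <= r * N * (N - t))%N by rewrite leq_mul2r DrN orbT.
  move: (N - t)%N (subnKC tN) => u <-; nia.
apply: (@leq_trans
  (\sum_(h : {ffun 'I_t -> 'I_N}) q ^ (t * (N - t) + (D - l)))).
  exact: leq_sum.
by rewrite sum_nat_const card_ffun !card_ord.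
Qed.

(** Group the functionals by the corank [t] of their catalecticant. For fixed [phi] every row of
    [Phi] lies in a space of dimension [E - (N - t)], and [t (N - t) + (D - l) <= r (N - t)] keeps
    the total exponent at most [r E]. *)
Lemma card_non_surjective :
  (N ^ 2 <= D)%N -> (D <= r * N)%N ->
  (#|non_surjective| * q.-1 <= rank_const * q ^ (r * E))%N.
Proof.
move=> ND DrN.
pose K (Phi : 'M[F]_(r, E)) :=
  [set phi : 'cV[F]_D | Phi *m (catalecticant phi)^T == 0].
have Nr : (N <= r)%N.
  by rewrite -(leq_pmul2r (bin_stars_gt0 n m)) mulnn; apply: leq_trans DrN.
have := @card_scalable_fibers F _ _ non_surjective K.
move=> /(_ _ _)/leq_trans; apply.
- move=> Phi; rewrite inE => /existsP[g /andP[g0 gP]].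
  by exists g; rewrite ?inE.
- move=> Phi c phi; rewrite !inE => /eqP phi0; apply/eqP.
  have -> : catalecticant (c *: phi) = c *: catalecticant phi.
    apply/matrixP => a b; rewrite [LHS]mxE [RHS]mxE -scalemxAr [LHS]mxE.
    by rewrite [in RHS]mxE.
  by rewrite linearZ /= -scalemxAr phi0 scaler0.
pose rk (phi : 'cV[F]_D) : 'I_N.+1 := inord (N - \rank (catalecticant phi)).
have rkE phi : rk phi = (N - \rank (catalecticant phi))%N :> nat.
  by rewrite inordK // ltnS leq_subr.
rewrite (partition_big rk xpredT) //= big_distrl /=; apply: leq_sum => t _.
have tN : (t <= N)%N by rewrite -ltnS.
set l := (t * (N - t) + D - r * (N - t))%N.
apply: (@weighted_count _ _ _ _ (q ^ (t * (N - t) + (D - l)))).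
- by rewrite expn_gt0 card_field_gt0.
- move=> phi /andP[_ /eqP phit]; have rC := rkE phi; rewrite phit in rC.
  have rN : \rank (catalecticant phi) = (N - t)%N.
    by rewrite rC subKn // rank_leq_row.
  have le1 : (#|[set Phi | phi \in K Phi]| <= q ^ (r * (E - (N - t))))%N.
    have := @card_ker F r _ _ (catalecticant phi)^T; rewrite mxrank_tr rN.
    apply: leq_trans; apply: subset_leq_card; apply/subsetP => Phi.
    by rewrite !inE.
  apply: leq_trans (leq_mul le1 (leqnn _)) _; rewrite -expnD.
  rewrite leq_pexp2l ?card_field_gt0 //.
  have : (N - t <= E)%N by rewrite -rN rank_leq_col.
  have : (t * (N - t) <= r * (N - t))%N.
    by rewrite leq_mul2r (leq_trans tN) ?orbT.
  rewrite /l; move: (N - t)%N => u le2 /subnKC; move: (E - u)%N => e <-.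
  rewrite mulnDr; nia.
- apply: leq_trans (card_small_catalecticant (leq_trans tN Nr) ND DrN).
  apply: subset_leq_card; apply/subsetP => phi; rewrite unfold_in inE.
  by move=> /andP[_ /eqP <-]; rewrite rkE.
Qed.

End Finite.
End GenericRank.

Section CombMatrix.
Variables (n d m r : nat).
Local Notation N := 'C(m + n, m).
Local Notation E := 'C(d + n, d).
Local Notation D := 'C(d + m + n, d + m).

Definition combr (R : comNzRingType) (Phi : 'M[R]_(r, E))
    (v : 'rV[R]_(r * N)) :=
  comb (m := m) Phi (vec_mx v).

Lemma combr_is_linear (R : comNzRingType) (Phi : 'M[R]_(r, E)) :
  linear (combr Phi).
Proof.
move=> k u v; rewrite /combr /comb scaler_sumr -big_split /=.
apply: eq_bigr => i _.
by rewrite linearP /= linearP /= linearP /= mulmxDr scalemxAr.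
Qed.
HB.instance Definition _ (R : comNzRingType) (Phi : 'M[R]_(r, E)) :=
  GRing.isLinear.Build R _ _ _ (combr Phi) (@combr_is_linear R Phi).

Definition comb_mx (R : comNzRingType) (Phi : 'M[R]_(r, E)) :
    'M[R]_(r * N, D) :=
  lin1_mx (combr Phi).

Lemma mul_comb_mx (R : comNzRingType) (Phi : 'M[R]_(r, E)) v :
  v *m comb_mx Phi = comb Phi (vec_mx v).
Proof. by rewrite mul_rV_lin1. Qed.

Lemma map_comb (R S : comNzRingType) (f : {rmorphism R -> S}) Phi
    (g : 'M[R]_(r, N)) :
  map_mx f (comb (d := d) Phi g) = comb (map_mx f Phi) (map_mx f g).
Proof.
rewrite /comb raddf_sum; apply: eq_bigr => i _ /=; rewrite map_mxM /= -!map_row.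
congr (_ *m _); rewrite /vec_mul raddf_sum; apply: eq_bigr => a _ /=.
rewrite map_mxZ; congr (_ *: _); first by rewrite !mxE.
apply/matrixP => b c.
by rewrite !mxE rmorph_nat.
Qed.

(** The entries are integral combinations of those of [Phi]; the case of interest is the evaluation
    of integer polynomials. *)
Lemma map_comb_mx (R S : comNzRingType) (f : {rmorphism R -> S})
    (Phi : 'M[R]_(r, E)) :
  map_mx f (comb_mx Phi) = comb_mx (map_mx f Phi).
Proof.
apply: map_lin1_mx => v; rewrite /combr map_comb; congr comb.
by rewrite map_vec_mx.
Qed.

Definition max_rank (R : fieldType) (Phi : 'M[R]_(r, E)) : Prop :=
  ((r * N <= D)%N -> row_free (comb_mx Phi)) /\
  ((D <= r * N)%N -> row_full (comb_mx Phi)).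

Lemma comb_mx_free (F : finFieldType) (Phi : 'M[F]_(r, E)) :
  Phi \notin non_injective n d m r F -> row_free (comb_mx Phi).
Proof.
rewrite inE negb_exists => /forallP inj; apply: inj_row_free => u uPhi.
have := inj (vec_mx u); rewrite -mul_comb_mx uPhi eqxx andbT negbK => /eqP u0.
by rewrite -[u]vec_mxK u0 linear0.
Qed.

(** A column killed by the matrix is a functional vanishing on the image; testing it on tuples [g]
    with a single monomial gives the equation of [non_surjective]. *)
Lemma comb_mx_full (F : finFieldType) (Phi : 'M[F]_(r, E)) :
  Phi \notin non_surjective n d m r F -> row_full (comb_mx Phi).
Proof.
rewrite inE negb_exists => /forallP surj.
suff : row_free (comb_mx Phi)^T by rewrite /row_free /row_full mxrank_tr.
apply: inj_row_free => u uPhi; have {}uPhi : comb_mx Phi *m u^T = 0.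
  by apply: trmx_inj; rewrite trmx_mul trmxK uPhi trmx0.
have := surj u^T; rewrite negb_and negbK.
have /eqP-> : Phi *m (catalecticant u^T)^T == 0.
  apply/eqP/matrixP => i a; pose g : 'M[F]_(r, N) := delta_mx i a.
  have : comb Phi g *m u^T = 0.
    by rewrite -(mxvecK g) -mul_comb_mx -mulmxA uPhi mulmx0.
  rewrite /comb (bigD1 i) //= big1 => [|j /negPf ji]; last first.
    rewrite (_ : row j g = 0) ?linear0 ?mulmx0 //.
    by apply/rowP => b; rewrite !mxE ji.
  rewrite addr0 -mulmxA -[vec_mul _ _ *m _]trmxK -mul_catalecticant.
  have -> : row i g = delta_mx 0 a by apply/rowP => b; rewrite !mxE !eqxx.
  rewrite -rowE => e0.
  transitivity ((row i Phi *m (row a (catalecticant u^T))^T) 0 0).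
    by rewrite !mxE; apply: eq_bigr => b _; rewrite !mxE.
  by rewrite e0 !mxE.
rewrite eqxx orbF => /eqP u0; apply: trmx_inj; by rewrite u0 trmx0.
Qed.

End CombMatrix.

(** * From finite fields to infinite fields *)

(** In characteristic [p] take a large power of [p]. In characteristic 0 the implication only
    concerns [c = 0], so any large finite field serves, here one of characteristic 2. *)
Lemma finite_field_above (k : fieldType) (K : nat) :
  exists2 F : finFieldType, (K < #|F|)%N &
    forall c : int, c%:~R = 0 :> k -> c%:~R = 0 :> F.
Proof.
have nat_int (F : fieldType) :
    (forall c : nat, c%:R = 0 :> k -> c%:R = 0 :> F) ->
    forall c : int, c%:~R = 0 :> k -> c%:~R = 0 :> F.
  move=> h [c|c]; first exact: h.
  rewrite NegzE !mulrNz => /eqP; rewrite oppr_eq0 => /eqP/h.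
  by rewrite -pmulrn => ->; rewrite oppr0.
have big p : prime p ->
    exists2 F : finFieldType, (K < #|F|)%N & p \in [pchar F].
  move=> pp; have [F pF cF] := PrimePowerField pp (ltn0Sn K).
  exists F => //; rewrite cF; apply: ltn_trans (ltn_expl _ (prime_gt1 pp)).
  exact: ltnSn.
have [[p pk]|char0] := classic (exists p, p \in [pchar k]).
  have [F KF pF] := big p (pcharf_prime pk).
  exists F => //; apply: nat_int => c /eqP; rewrite -(dvdn_pcharf pk) => pc.
  by apply/eqP; rewrite -(dvdn_pcharf pF).
have [F KF _] := big 2%N isT; exists F => //; apply: nat_int => c /eqP.
have /pcharf0P-> : [pchar k] =i pred0.
  by move=> p; apply/negbTE/negP => pk; apply: char0; exists p.
by move/eqP ->.
Qed.

Lemma infinite_uniq_seq (k : fieldType) (s : nat) :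
  infinite_type k -> exists2 rs : seq k, uniq rs & size rs = s.
Proof.
move=> inf; elim: s => [|s [rs urs srs]]; first by exists [::].
have [x xrs] : exists x, x \notin rs.
  apply: NNPP => no; apply: inf; exists rs => x; apply: contraT => xrs.
  by case: no; exists x.
by exists (x :: rs); rewrite /= ?xrs ?srs.
Qed.

Lemma infinite_nonroot (k : fieldType) (p : {poly k}) :
  infinite_type k -> p != 0 -> exists x, p.[x] != 0.
Proof.
move=> inf p0; have [rs urs srs] := infinite_uniq_seq (size p) inf.
apply: NNPP => no; have : all (root p) rs.
  by apply/allP => x _; apply: contraT => px; case: no; exists x.
by move=> /(max_poly_roots p0)/(_ urs); rewrite srs ltnn.
Qed.

Definition ev (F : fieldType) (x : F) (p : {poly int}) : F :=
  (map_poly intr p).[x].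

Lemma ev_is_zmod (F : fieldType) (x : F) : zmod_morphism (ev x).
Proof. by move=> p q; rewrite /ev rmorphB hornerD hornerN. Qed.
Lemma ev_is_monoid (F : fieldType) (x : F) : monoid_morphism (ev x).
Proof. by split=> [|p q]; rewrite /ev ?rmorph1 ?hornerC // rmorphM hornerM. Qed.
HB.instance Definition _ (F : fieldType) (x : F) :=
  GRing.isZmodMorphism.Build {poly int} F (ev x) (ev_is_zmod x).
HB.instance Definition _ (F : fieldType) (x : F) :=
  GRing.isMonoidMorphism.Build {poly int} F (ev x) (ev_is_monoid x).

Lemma finite_field_lift (F : finFieldType) :
  exists x : F, exists lift : F -> {poly int}, cancel lift (ev x).
Proof.
have /cyclicP[u uG] := field_unit_group_cyclic [set: {unit F}]%G.
have ex a : exists p : {poly int}, ev (val u) p == a.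
  have [->|a0] := eqVneq a 0; first by exists 0; rewrite raddf0.
  have ua : a \is a GRing.unit by rewrite unitfE.
  have /cycleP[i ai] : FinRing.unit F ua \in <[u]>%g by rewrite -uG inE.
  exists 'X^i; rewrite /ev map_polyXn hornerXn.
  by have /(congr1 val) := ai; rewrite /= FinRing.val_unitX => ->.
exists (val u), (fun a => xchoose (ex a)) => a.
exact/eqP/(xchooseP (ex a)).
Qed.

(** Some coefficient of [p] is nonzero in [F], hence in [k], and a nonzero polynomial over an
    infinite field has a nonroot. *)
Lemma ev_transfer (k : fieldType) (F : finFieldType) (x : F) (p : {poly int}) :
  infinite_type k -> (forall c : int, c%:~R = 0 :> k -> c%:~R = 0 :> F) ->
  ev x p != 0 -> exists t : k, ev t p != 0.
Proof.
move=> inf kF px; apply: infinite_nonroot => //; apply: contraNneq px => p0.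
rewrite /ev (_ : map_poly intr p = 0) ?horner0 //.
apply/polyP => i; rewrite coef0 coef_map; apply: kF.
by rewrite -(coef_map (intr : int -> k)) p0 coef0.
Qed.

(* A right inverse of [map_mx (ev x) A] lifts along [ev x], and the determinant
   of the lifted product evaluates to [1]. *)
Lemma lift_row_free (k : fieldType) (F : finFieldType) (x : F)
    (lift : F -> {poly int}) (a b : nat) (A : 'M[{poly int}]_(a, b)) :
  cancel lift (ev x) -> row_free (map_mx (ev x) A) ->
  exists2 p, ev x p != 0 &
    forall t : k, ev t p != 0 -> row_free (map_mx (ev t) A).
Proof.
move=> liftK /row_freeP[B AB]; exists (\det (A *m map_mx lift B)).
  rewrite -det_map_mx map_mxM /= -map_mx_comp (map_mx_id liftK) AB det1.
  exact: oner_neq0.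
move=> t; rewrite -det_map_mx map_mxM -unitfE -[_ \is a _]/(_ \in unitmx).
rewrite -row_free_unit /row_free => /eqP full; rewrite eqn_leq rank_leq_row.
by rewrite -[leqLHS]full mxrankM_maxl.
Qed.

Lemma lift_row_full (k : fieldType) (F : finFieldType) (x : F)
    (lift : F -> {poly int}) (a b : nat) (A : 'M[{poly int}]_(a, b)) :
  cancel lift (ev x) -> row_full (map_mx (ev x) A) ->
  exists2 p, ev x p != 0 &
    forall t : k, ev t p != 0 -> row_full (map_mx (ev t) A).
Proof.
move=> liftK; rewrite /row_full -mxrank_tr map_trmx => Afull.
have [p px pA] := lift_row_free k liftK Afull; exists p => // t /pA.
by rewrite /row_free -map_trmx mxrank_tr.
Qed.

Lemma lift_max_rank (k : fieldType) (F : finFieldType) (x : F)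
    (lift : F -> {poly int}) (n d m r : nat) (Phi : 'M[F]_(r, 'C(d + n, d))) :
  cancel lift (ev x) -> max_rank m Phi ->
  exists2 p, ev x p != 0 & forall t : k, ev t p != 0 ->
    max_rank m (map_mx (ev t) (map_mx lift Phi)).
Proof.
move=> liftK [free full]; set Psi := map_mx lift Phi.
have PsiE : map_mx (ev x) Psi = Phi by rewrite -map_mx_comp (map_mx_id liftK).
have [p px pt] : exists2 p, ev x p != 0 & forall t : k, ev t p != 0 ->
    (r * 'C(m + n, m) <= 'C(d + m + n, d + m))%N ->
    row_free (comb_mx m (map_mx (ev t) Psi)).
  (* When the dimensions ask for nothing, the constant polynomial 1 serves. *)
  have [le|_] := leqP; last by exists 1; rewrite ?rmorph1 ?oner_eq0.
  have := free le; rewrite -PsiE -map_comb_mx.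
  case/(lift_row_free k liftK) => p px pt.
  by exists p => // t /pt; rewrite map_comb_mx.
have [p' p'x p't] : exists2 p, ev x p != 0 & forall t : k, ev t p != 0 ->
    ('C(d + m + n, d + m) <= r * 'C(m + n, m))%N ->
    row_full (comb_mx m (map_mx (ev t) Psi)).
  have [le|_] := leqP; last by exists 1; rewrite ?rmorph1 ?oner_eq0.
  have := full le; rewrite -PsiE -map_comb_mx.
  case/(lift_row_full k liftK) => p' p'x p't.
  by exists p' => // t /p't; rewrite map_comb_mx.
exists (p * p') => [|t]; first by rewrite rmorphM mulf_neq0.
by rewrite rmorphM mulf_eq0 negb_or => /andP[/pt ? /p't ?].
Qed.

Lemma finite_max_rank (n d d' r : nat) (F : finFieldType) :
  (forall m, (m <= d')%N -> ('C(m + n, m) ^ 2 <= 'C(d + m + n, d + m))%N) ->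
  (\sum_(m < d'.+1) 2 * rank_const n m < #|F|.-1)%N ->
  exists Phi : 'M[F]_(r, 'C(d + n, d)), forall m, (m <= d')%N -> max_rank m Phi.
Proof.
move=> ND; set K := (\sum_(m < _) _)%N => KF.
(* A kind of failure counts as bad only where the dimensions exclude it; the two kinds for each [m]
   account for the factor 2 in [K]. *)
pose B m := (if (r * 'C(m + n, m) <= 'C(d + m + n, d + m))%N
             then non_injective n d m r F else set0) :|:
  (if ('C(d + m + n, d + m) <= r * 'C(m + n, m))%N
   then non_surjective n d m r F else set0).
have [Phi PhiB] : exists Phi, Phi \notin \bigcup_(m < d'.+1) B m.
  suff lt : (#|\bigcup_(m < d'.+1) B m| < #|'M[F]_(r, 'C(d + n, d))|)%N.
    have : ~~ [forall Phi, Phi \in \bigcup_(m < d'.+1) B m].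
      apply: contraL lt => /forallP all; rewrite -leqNgt -cardsT.
      by apply: subset_leq_card; apply/subsetP => Phi _.
    by rewrite negb_forall => /existsP.
  have q1 : (0 < #|F|.-1)%N by apply: leq_ltn_trans KF.
  rewrite -(ltn_pmul2r q1) card_mx.
  apply: (@leq_ltn_trans (K * #|F| ^ (r * 'C(d + n, d)))); last first.
    by rewrite mulnC ltn_pmul2l ?expn_gt0 ?card_field_gt0.
  rewrite (leq_trans (leq_mul (card_bigcup_le _ _) (leqnn _))) //.
  rewrite !big_distrl /=; apply: leq_sum => m _.
  have ND' : ('C(m + n, m) ^ 2 <= 'C(d + m + n, d + m))%N.
    by apply: ND; rewrite -ltnS.
  rewrite (leq_trans (leq_mul (leq_card_setU _ _) (leqnn _))) //.
  rewrite mulnDl -mulnA mul2n -addnn; apply: leq_add.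
    by case: ifP => [le|_]; [exact: card_non_injective | rewrite cards0].
  by case: ifP => [le|_]; [exact: card_non_surjective | rewrite cards0].
exists Phi => m md'; have : Phi \notin B m.
  apply: contra PhiB => PhiB; apply/bigcupP.
  by exists (inord m); rewrite ?inordK.
rewrite /B in_setU negb_or => /andP[inj surj]; split=> le.
  by apply: comb_mx_free; rewrite le in inj.
by apply: comb_mx_full; rewrite le in surj.
Qed.

Lemma generic_max_rank (k : fieldType) (n d d' r : nat) :
  infinite_type k ->
  (forall m, (m <= d')%N -> ('C(m + n, m) ^ 2 <= 'C(d + m + n, d + m))%N) ->
  exists Phi : 'M[k]_(r, 'C(d + n, d)), forall m, (m <= d')%N -> max_rank m Phi.
Proof.
move=> inf ND.
have [F KF kF] := finite_field_above k (\sum_(m < d'.+1) 2 * rank_const n m).+1.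
have [|Phi PhiP] := @finite_max_rank n d d' r F ND.
  by rewrite -ltnS prednK ?card_field_gt0.
have [x [lift liftK]] := finite_field_lift F.
have ex (m : 'I_d'.+1) : exists p, ev x p != 0 /\ forall t : k, ev t p != 0 ->
    max_rank m (map_mx (ev t) (map_mx lift Phi)).
  have md' : (m <= d')%N by rewrite -ltnS.
  by have [p px pt] := lift_max_rank k liftK (PhiP m md'); exists p.
have [p pP] := functional_choice _ ex.
(* Nonvanishing of the product makes one parameter [t] serve all degrees [m] at once. *)
have [|t tp] := @ev_transfer k F x (\prod_m p m) inf kF.
  by rewrite rmorph_prod; apply/prodf_neq0 => m _; apply: (pP m).1.
exists (map_mx (ev t) (map_mx lift Phi)) => m md'.
have := (pP (inord m)).2 t; rewrite inordK //; apply.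
by move: tp; rewrite rmorph_prod => /prodf_neq0/(_ (inord m) isT).
Qed.

(** * Hilbert functions *)

Section Forms.
Variables (k : fieldType) (n : nat).

Definition form_of (i : nat) (v : 'rV[k]_('C(i + n, i))) : {mpoly k[n.+1]} :=
  \sum_a v 0 a *: 'X_[mon a].

Lemma form_is_linear i : linear (@form_of i).
Proof.
move=> c u v; rewrite /form_of scaler_sumr -big_split /=.
by apply: eq_bigr => a _; rewrite !mxE scalerDl scalerA.
Qed.
HB.instance Definition _ i :=
  GRing.isLinear.Build k _ _ _ (@form_of i) (@form_is_linear i).

Lemma form_homog i v : @form_of i v \is i.-homog.
Proof.
by apply: rpred_sum => a _; rewrite rpredZ // dhomogX; apply/eqP/mdeg_mon.
Qed.

Lemma mcoeff_form i v a : (@form_of i v)@_(mon a) = v 0 a.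
Proof.
rewrite raddf_sum (bigD1 a) //= mcoeffZ mcoeffX eqxx mulr1.
rewrite big1 ?addr0 // => b ba.
by rewrite mcoeffZ mcoeffX (inj_eq (@mon_inj _ _)) (negPf ba) mulr0.
Qed.

Lemma form_inj i : injective (@form_of i).
Proof. by move=> u v uv; apply/rowP => a; rewrite -!mcoeff_form uv. Qed.

Lemma form_coefs i (p : {mpoly k[n.+1]}) :
  p \is i.-homog -> @form_of i (\row_a p@_(mon a)) = p.
Proof.
move=> hp; apply/mpolyP => u; have [ui|ui] := eqVneq (mdeg u) i.
  by have [a ->] := monP ui; rewrite mcoeff_form mxE.
by rewrite (dhomog_nemf_coeff hp ui) (dhomog_nemf_coeff (form_homog _) ui).
Qed.

Lemma form_mul d m (v : 'rV_('C(m + n, m))) (w : 'rV_('C(d + n, d))) :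
  form_of v * form_of w = form_of (w *m vec_mul d v).
Proof.
rewrite /form_of big_distrl /=.
transitivity
  (\sum_a \sum_b (v 0 a * w 0 b) *: 'X_[mon a + mon b] : {mpoly k[n.+1]}).
  apply: eq_bigr => a _; rewrite big_distrr /=; apply: eq_bigr => b _.
  by rewrite -scalerAl -scalerAr scalerA mpolyXD.
rewrite exchange_big /=.
under [RHS]eq_bigr do rewrite mxE scaler_suml.
rewrite [RHS]exchange_big /=; apply: eq_bigr => b _.
under [RHS]eq_bigr do rewrite vec_mulE big_distrr /= scaler_suml.
rewrite [RHS]exchange_big /=; apply: eq_bigr => a _.
have [|c cE] := @monP n (d + m) (mon a + mon b)%MM.
  by rewrite mdegD !mdeg_mon addnC.
rewrite (bigD1 c) //= cE eqxx mulr1 mulrC big1 ?addr0 // => c' /negPf c'c.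
by rewrite (inj_eq (@mon_inj _ _)) c'c !mulr0 scale0r.
Qed.

(** Only the terms of [g] of degree [i - d] contribute; written additively, the condition also
    covers [i < d], where the sum is empty. *)
Lemma pihomog_mul_homog d i (g f : {mpoly k[n.+1]}) : f \is d.-homog ->
  pihomog mdeg i (g * f) =
    \sum_(u <- msupp g | (mdeg u + d == i)%N) g@_u *: ('X_[u] * f).
Proof.
move=> hf; rewrite {1}[g]mpolyE big_distrl /=.
rewrite (linear_sum (pihomog mdeg i)) [RHS]big_mkcond /=.
apply: eq_bigr => u _; rewrite -scalerAl (linearZ_LR (pihomog mdeg i)) /=.
have hX : 'X_[u] * f \is (mdeg u + d).-homog by rewrite dhomogM // dhomogX.
case: eqP => [<-|ui]; first by rewrite pihomog_dE.
by rewrite (pihomog_ne0 _ hX) ?scaler0 //; apply/eqP.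
Qed.

Variables (d r : nat) (Phi : 'M[k]_(r, 'C(d + n, d))).
Let f (j : 'I_r) : {mpoly k[n.+1]} := form_of (row j Phi).

Lemma form_comb m (v : 'rV_(r * 'C(m + n, m))) :
  form_of (v *m comb_mx m Phi) = \sum_j form_of (row j (vec_mx v)) * f j.
Proof.
rewrite mul_comb_mx /comb linear_sum; apply: eq_bigr => j _.
by rewrite form_mul.
Qed.

Lemma ideal_gen_low i p : (i < d)%N -> p \is i.-homog -> ideal_gen f p -> p = 0.
Proof.
move=> id hp [g pg]; rewrite -(pihomog_dE hp) pg.
rewrite (linear_sum (pihomog mdeg i)) big1 // => j _.
rewrite /= (@pihomog_mul_homog d) ?form_homog // big1 // => u /eqP; lia.
Qed.

(** By homogeneity each multiplier [g j] may be replaced by its component of degree [m]. *)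
Lemma ideal_gen_form m p : p \is (d + m).-homog ->
  ideal_gen f p <-> exists v, p = form_of (v *m comb_mx m Phi).
Proof.
move=> hp; split=> [[g pg]|[v ->]]; last first.
  by exists (fun j => form_of (row j (vec_mx v))); rewrite form_comb.
pose w j : 'rV_('C(m + n, m)) := \row_a (pihomog mdeg m (g j))@_(mon a).
exists (mxvec (\matrix_j w j)); rewrite form_comb mxvecK.
rewrite -(pihomog_dE hp) {1}pg (linear_sum (pihomog mdeg _)).
apply: eq_bigr => j _ /=.
rewrite rowK form_coefs ?pihomogP // (@pihomog_mul_homog d) ?form_homog //.
rewrite pihomogE big_distrl /=; apply: eq_big => [u|u _].
  by rewrite addnC eqn_add2l.
by rewrite scalerAl.
Qed.

Definition dform i (v : 'rV_('C(i + n, i))) : dhomog n.+1 k i :=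
  DHomog (form_homog v).

Lemma dform_is_linear i : linear (@dform i).
Proof. by move=> c u v; apply: val_inj; rewrite /= linearP. Qed.
HB.instance Definition _ i :=
  GRing.isLinear.Build k _ _ _ (@dform i) (@dform_is_linear i).

Lemma dim_dhomog i : \dim {: dhomog n.+1 k i} = 'C(i + n, i).
Proof. by rewrite dimvf. Qed.

Lemma quot_dim_low i : (i < d)%N -> quot_dim (ideal_gen f) i 'C(i + n, i).
Proof.
move=> id; exists 0%VS; last by rewrite dimv0 subn0 dim_dhomog.
move=> p; split; first by rewrite memv0 => /eqP ->; exists (fun=> 0);
  rewrite big1 // => j _; rewrite mul0r.
move=> If; rewrite memv0; apply/eqP/val_inj.
by apply: (ideal_gen_low id) If; apply: dhomog_is_dhomog.
Qed.

(** Passing from coefficient rows to forms is injective, so the dimension of the ideal in this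
    degree can be computed on rows. *)
Lemma quot_dim_high m :
  quot_dim (ideal_gen f) (d + m)
    ('C(d + m + n, d + m) -
       \dim (limg (linfun (@mulmxr k 1 _ _ (comb_mx m Phi))))).
Proof.
set M := linfun _.
pose L : 'Hom('rV[k]_('C(d + m + n, d + m)), dhomog n.+1 k (d + m)) :=
  linfun (@dform _).
exists (limg (L \o M)%VF).
  move=> p; rewrite ideal_gen_form; last exact: dhomog_is_dhomog.
  split=> [/memv_imgP[v _ ->]|[v pv]].
    by exists v; rewrite comp_lfunE !lfunE.
  apply/memv_imgP; exists v; rewrite ?memvf // comp_lfunE !lfunE /=.
  exact: val_inj.
rewrite dim_dhomog limg_comp [\dim (L @: _)]limg_dim_eq //.
apply/eqP; rewrite -subv0; apply/subvP => v; rewrite memv_cap memv_ker lfunE /=.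
case/andP=> _ /eqP/(congr1 val)/= v0; rewrite memv0; apply/eqP/form_inj.
by rewrite v0 linear0.
Qed.

Lemma quot_dim_free m : row_free (comb_mx m Phi) ->
  quot_dim (ideal_gen f) (d + m) ('C(d + m + n, d + m) - r * 'C(m + n, m)).
Proof.
move=> free; have := quot_dim_high m.
rewrite limg_dim_eq ?dimvf /dim /= ?mul1n //.
apply/eqP; rewrite -subv0; apply/subvP => v; rewrite memv_cap memv_ker lfunE /=.
case/andP=> _ /eqP v0; rewrite memv0; apply/eqP.
by apply: (row_free_inj free); rewrite v0 mul0mx.
Qed.

Lemma quot_dim_full m : row_full (comb_mx m Phi) ->
  quot_dim (ideal_gen f) (d + m) 0.
Proof.
move=> full; have := quot_dim_high m; set U := limg _.
have -> : U = fullv.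
  apply/vspaceP => v; rewrite memvf; apply/memv_imgP.
  have /submxP[w vw] := submx_full v full.
  by exists w; rewrite ?memvf // lfunE /=.
by rewrite dimvf /dim /= mul1n subnn.
Qed.
End Forms.

(** * Coefficients of the conjectured Hilbert series *)

Lemma inv_pow_seriesE n i : inv_pow_series n.+1 i = 'C(i + n, i)%:Z.
Proof.
elim: n i => [|n IHn] i.
  rewrite /inv_pow_series /= series_mulC series_mul1 addn0 binn //.
rewrite /inv_pow_series iterS -/(inv_pow_series n.+1) /series_mul.
rewrite (eq_bigr (fun j : 'I_i.+1 => 'C(i - j + n, i - j)%:Z)); last first.
  by move=> j _; rewrite mul1r IHn.
rewrite (reindex_inj rev_ord_inj) /=.
rewrite (eq_bigr (fun j : 'I_i.+1 => 'C(j + n, j)%:Z)) => [|j _]; last first.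
  by rewrite subSS subKn // -ltnS.
elim: i => [|i IHi]; first by rewrite big_ord1 !bin0.
by rewrite big_ord_recr /= IHi -PoszD !addnS !addSn binS addnC.
Qed.

(** Modulo [X ^ (2 d)] the binomial expansion stops at its linear term in [X ^ d]. *)
Lemma coef_pow_1subXn d r l : (0 < d)%N -> (l < 2 * d)%N ->
  ((1 - 'X^d) ^+ r : {poly int})`_l = (l == 0%N)%:R - (l == d)%:R * r%:Z.
Proof.
move=> d0 ld; elim: r l ld => [|r IHr] l ld.
  by rewrite expr0 coef1 mulr0 subr0.
rewrite exprS mulrBl mul1r coefB coefXnM IHr //.
have [ld'|dl] := ltnP l d.
  by rewrite (ltn_eqF ld') !mul0r subr0.
rewrite IHr; last lia.
rewrite (gtn_eqF (leq_trans d0 dl)) (_ : (l - d == d)%N = false); last lia.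
rewrite (_ : (l - d == 0)%N = (l == d)); last lia.
by case: eqP => _; rewrite ?mul0r ?mul1r -?intS; lia.
Qed.

(** As [d' < d], the range contains all degrees up to [d + d']. At [d + m] the value is [D - r N],
    the dimension of the quotient when the map is injective. *)
Lemma froberg_quotientE n d r i : (0 < d)%N -> (i < 2 * d)%N ->
  froberg_quotient n.+1 d r i =
    'C(i + n, i)%:Z -
      (if (d <= i)%N then r%:Z * 'C(i - d + n, i - d)%:Z else 0).
Proof.
move=> d0 id; rewrite /froberg_quotient /series_mul /series_of_poly.
rewrite (eq_bigr (fun j : 'I_i.+1 =>
   (val j == 0%N)%:R * 'C(i - j + n, i - j)%:Z -
   (val j == d)%:R * r%:Z * 'C(i - j + n, i - j)%:Z)) => [|j _]; last first.
  rewrite coef_pow_1subXn ?inv_pow_seriesE ?mulrBl //.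
  by apply: leq_ltn_trans id; rewrite -ltnS.
rewrite sumrB; congr (_ - _).
  by rewrite big_ord_recl /= mul1r subn0 big1 ?addr0.
case: leqP => [di|id'].
  have di' : (d < i.+1)%N by [].
  rewrite (bigD1 (Ordinal di')) //= eqxx mul1r big1 ?addr0 // => j jd.
  by rewrite (_ : (val j == d) = false) ?mul0r //; apply: contraNF jd.
by rewrite big1 // => j _; rewrite (ltn_eqF (leq_trans (ltn_ord j) id')) !mul0r.
Qed.

(** * Monotonicity of [D / N] in [m] *)

Lemma mul_bin_stars n a :
  (a.+1 * 'C(a.+1 + n, a.+1) = (a + n).+1 * 'C(a + n, a))%N.
Proof. by rewrite -mul_bin_diag addSn. Qed.

(** From [m] to [m + 1], [D] is multiplied by [1 + n / (d + m + 1)] and [N] by [1 + n / (m + 1)],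
    which is at least as large. *)
Lemma bin_ratio_step n d m :
  ('C(d + m.+1 + n, d + m.+1) * 'C(m + n, m) <=
   'C(d + m + n, d + m) * 'C(m.+1 + n, m.+1))%N.
Proof.
rewrite addnS.
have eD := mul_bin_stars n (d + m); have eN := mul_bin_stars n m.
rewrite -(leq_pmul2l (ltn0Sn m)) -(leq_pmul2l (ltn0Sn (d + m))).
set D := 'C(_ + n, d + m) in eD *; set D' := 'C(_, _.+1) in eD *.
set N := 'C(m + n, m) in eN *; set N' := 'C(_, _.+1) in eN *.
have -> : ((d + m).+1 * (m.+1 * (D' * N)) =
           m.+1 * (d + m + n).+1 * (D * N))%N.
  by rewrite -[in RHS]mulnA [((d + m + n).+1 * _)%N]mulnA -eD; lia.
have -> : ((d + m).+1 * (m.+1 * (D * N')) =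
           (d + m).+1 * (m + n).+1 * (D * N))%N.
  by rewrite -[in RHS]mulnA [(D * N)%N]mulnC [((m + n).+1 * _)%N]mulnA -eN; lia.
by rewrite leq_mul2r; apply/orP; right; nia.
Qed.

(** As [m] decreases, [D / N] does not decrease and [N] does not increase. This spreads the
    hypothesis in degree [d'] to all smaller degrees. *)
Lemma bin_square_antimono n d m d' : (m <= d')%N ->
  ('C(d' + n, d') ^ 2 <= 'C(d + d' + n, d + d'))%N ->
  ('C(m + n, m) ^ 2 <= 'C(d + m + n, d + m))%N.
Proof.
move/subnKC <-; elim: (d' - m)%N => [|e IHe]; first by rewrite addn0.
rewrite addnS => h; apply: IHe; move: (m + e)%N h => {}m h.
have N'0 := bin_stars_gt0 n m.+1.
have NN' : ('C(m + n, m) <= 'C(m.+1 + n, m.+1))%N.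
  by rewrite addSn binS leq_addl.
rewrite -(leq_pmul2r N'0); apply: leq_trans (bin_ratio_step n d m).
rewrite expnS expn1 mulnC mulnA leq_mul2r; apply/orP; right.
by apply: leq_trans h; rewrite expnS expn1 leq_mul2l NN' orbT.
Qed.

(** Since [D / N] does not increase, non-positivity of [D - r N] persists; contrapositively, a
    positive coefficient has only positive ones before it, as the truncation demands. *)
Lemma bin_ratio_mono n d r m m' : (m <= m')%N ->
  ('C(d + m + n, d + m) <= r * 'C(m + n, m))%N ->
  ('C(d + m' + n, d + m') <= r * 'C(m' + n, m'))%N.
Proof.
move/subnKC <-; elim: (m' - m)%N => [|e IHe] h; first by rewrite addn0.
move: {IHe h}(IHe h); rewrite addnS; move: (m + e)%N => {}m h.
rewrite -(leq_pmul2r (bin_stars_gt0 n m)).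
apply: leq_trans (bin_ratio_step n d m) _.
by rewrite mulnAC leq_mul2r h orbT.
Qed.

Theorem theorem6 (k : fieldType) (k_infinite : infinite_type k)
    (n d d' : nat) (d'_gt0 : (0 < d')%N) (d'_lt_d : (d' < d)%N)
    (dim_ge : ((\dim {: dhomog n.+1 k d'}) ^ 2
                 <= \dim {: dhomog n.+1 k (d + d')})%N)
    (d'_le : (d' <= 2100)%N)
    (r : nat) (r_gt0 : (0 < r)%N) :
  exists2 f : 'I_r -> {mpoly k[n.+1]},
    forall j : 'I_r, f j \is d.-homog
    & forall i : nat, (i <= d + d')%N ->
        exists2 m : nat, quot_dim (ideal_gen f) i m
          & Posz m = froberg_series n.+1 d r i.
Proof.
have d0 : (0 < d)%N by apply: leq_trans d'_lt_d.
rewrite !dim_dhomog in dim_ge.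
have [Phi PhiP] := @generic_max_rank k n d d' r k_infinite
  (fun m md' => bin_square_antimono md' dim_ge).
exists (fun j => form_of (row j Phi)) => [j|i id']; first exact: form_homog.
have quotE l : (l <= i)%N -> froberg_quotient n.+1 d r l =
    'C(l + n, l)%:Z -
      (if (d <= l)%N then r%:Z * 'C(l - d + n, l - d)%:Z else 0).
  by move=> li; apply: froberg_quotientE => //; lia.
have quot_low l : (l <= i)%N -> (l < d)%N -> 0 < froberg_quotient n.+1 d r l.
  by move=> li ld; rewrite quotE // leqNgt ld subr0 ltz_nat bin_stars_gt0.
have series_pos : (forall l, (l <= i)%N -> 0 < froberg_quotient n.+1 d r l) ->
    froberg_series n.+1 d r i = froberg_quotient n.+1 d r i.
  move=> pos; rewrite /froberg_series /series_truncate.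
  by case: forallP => // -[] j; apply: pos; rewrite -ltnS.
have [ltid|leid] := ltnP i d.
  exists 'C(i + n, i); first exact: quot_dim_low.
  rewrite series_pos => [|l li]; last first.
    by apply: quot_low => //; apply: leq_ltn_trans ltid.
  by rewrite quotE // leqNgt ltid subr0.
move: (subnKC leid) id' quotE quot_low series_pos.
set m := (i - d)%N => {leid}<-.
rewrite leq_add2l => md' quotE quot_low series_pos.
have [free full] := PhiP m md'.
have quot_high l : (l <= m)%N -> froberg_quotient n.+1 d r (d + l) =
    'C(d + l + n, d + l)%:Z - (r * 'C(l + n, l))%N%:Z.
  by move=> lm; rewrite quotE ?leq_add2l // leq_addr addKn.
(* If [D <= r N], the coefficient in degree [d + m] is non-positive, the series is cut there and the
   map is onto. Otherwise the map is injective, and all coefficients up to this degree must be shown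
   positive. *)
have [Dr|rD] := leqP 'C(d + m + n, d + m) (r * 'C(m + n, m)).
  exists 0%N; first exact: quot_dim_full (full Dr).
  rewrite /froberg_series /series_truncate; case: forallP => // /(_ ord_max).
  by rewrite /= quot_high // subr_gt0 ltz_nat ltnNge Dr.
exists ('C(d + m + n, d + m) - r * 'C(m + n, m))%N.
  by apply: quot_dim_free; apply: free; apply: ltnW.
rewrite series_pos => [|l lm]; first by rewrite quot_high // -subzn // ltnW.
have [|dl] := ltnP l d; first exact: quot_low.
move: lm; rewrite -(subnKC dl) leq_add2l => lm.
rewrite quot_high // subr_gt0 ltz_nat ltnNge; apply: contraL rD => h.
by rewrite -leqNgt; apply: bin_ratio_mono lm h.
Qed.
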